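(* Let $\alpha \ge 2$ be real, let $n\ge 2$, and let $\rho_{A_1A_2\cdots A_n}$ be any density operator on the $n$-qubit space $(\mathbb{C}^2)^{\otimes n}$, the tensor factors being labelled $A_1,\dots,A_n$. Then $$E_\alpha\left(\rho_{A_1(A_2\cdots A_n)}\right)\ \ge\ E_\alpha\left(\rho_{A_1A_2}\right)+\cdots+E_\alpha\left(\rho_{A_1A_n}\right),$$ where $E_\alpha(\rho_{A_1(A_2\cdots A_n)})$ is the Rényi-$\alpha$ entanglement of $\rho_{A_1A_2\cdots A_n}$ with respect to the bipartite cut between $A_1$ and the remaining qubits $A_2\cdots A_n$ (i.e. regarding it as a bipartite state on $\mathbb{C}^2\otimes\mathbb{C}^{2^{n-1}}$), and, for $i=2,\dots,n$, $E_\alpha(\rho_{A_1A_i})$ is the Rényi-$\alpha$ entanglement of the reduced density matrix $\rho_{A_1A_i}$ on the two-qubit subsystem $A_1A_i$ (the partial trace over all other qubits).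
   Context: All logarithms are base 2. For $\alpha>0$, $\alpha\ne 1$, the quantum Rényi-$\alpha$ entropy of a density operator $\rho$ is $S_\alpha(\rho)=\frac{1}{1-\alpha}\log \operatorname{tr}\rho^\alpha$. For a bipartite pure state (unit vector) $|\psi\rangle_{AB}$ in a tensor product of two finite-dimensional complex Hilbert spaces, with reduced state $\rho_A=\operatorname{tr}_B|\psi\rangle_{AB}\langle\psi|$, the Rényi-$\alpha$ entanglement is $E_\alpha(|\psi\rangle_{AB})=S_\alpha(\rho_A)$. For a bipartite density operator $\rho_{AB}$, the Rényi-$\alpha$ entanglement is $E_\alpha(\rho_{AB})=\min\sum_i p_i E_\alpha(|\psi_i\rangle_{AB})$, where the minimum is over all pure state decompositions $\rho_{AB}=\sum_i p_i|\psi_i\rangle_{AB}\langle\psi_i|$ (with $p_i\ge 0$, $\sum_i p_i=1$, and each $|\psi_i\rangle_{AB}$ a unit vector). *)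

(* Defs.v *)
From HB Require Import structures.
From mathcomp Require Import all_boot all_order all_algebra.
From mathcomp Require Import all_classical all_reals all_analysis.
From mathcomp Require Import complex.

Set Implicit Arguments.
Unset Strict Implicit.
Unset Printing Implicit Defensive.

Import Order.TTheory GRing.Theory Num.Theory.
Local Open Scope classical_set_scope.
Local Open Scope ring_scope.
Local Open Scope sesquilinear_scope.

(* A finite type T stands for the Hilbert space C^T with its computational
   basis (|t>)_{t : T}; C^(A * B) is C^A (x) C^B, with |(a, b)> = |a> (x) |b>,
   and C^{ffun 'I_n -> 'I_2} is (C^2)^{(x) n}. Kets and operators are column
   vectors and matrices whose indices are the ranks of the basis labels. *)
Definition ket (R : realType) (T : finType) := 'cV[R[i]]_#|T|.

Definition op (R : realType) (T : finType) := 'M[R[i]]_#|T|.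

Definition entry (R : realType) (T : finType) (M : op R T) (s t : T) : R[i] :=
  M (enum_rank s) (enum_rank t).

Definition mkop (R : realType) (T : finType) (F : T -> T -> R[i]) : op R T :=
  \matrix_(i, j) F (enum_val i) (enum_val j).

Definition unit_ket (R : realType) (T : finType) (psi : ket R T) : Prop :=
  psi ^t* *m psi = 1%:M.

Definition proj_ket (R : realType) (T : finType) (psi : ket R T) : op R T :=
  psi *m psi ^t*.

Definition density (R : realType) (T : finType) (rho : op R T) : Prop :=
  [/\ rho \is hermsymmx,
      forall v : ket R T, 0 <= (v ^t* *m rho *m v) 0 0
    & \tr rho = 1].

Definition log2 (R : realType) (x : R) : R := ln x / ln 2.

(* Real power of a positive semidefinite matrix by functional calculus: if
   M = U^-1 D U with U unitary and D diagonal, then M^alpha = U^-1 D^alpha U.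
   Since 0 `^ alpha = 0 for alpha != 0, the kernel of M contributes nothing. *)
Definition mxpowR (R : realType) (n : nat) (M : 'M[R[i]]_n) (alpha : R) :
    'M[R[i]]_n :=
  invmx (spectralmx M)
    *m diag_mx (\row_j (powR (complex.Re (spectral_diag M 0 j)) alpha)%:C%C)
    *m spectralmx M.

Definition renyi_entropy (R : realType) (T : finType) (alpha : R)
    (rho : op R T) : R :=
  (1 - alpha)^-1 * log2 (complex.Re (\tr (mxpowR rho alpha))).

Definition ptrace_r (R : realType) (A B : finType) (rho : op R (A * B)%type) :
    op R A :=
  mkop (fun a a' => \sum_(b : B) entry rho (a, b) (a', b)).

Definition pure_renyi_ent (R : realType) (A B : finType) (alpha : R)
    (psi : ket R (A * B)%type) : R :=
  renyi_entropy alpha (ptrace_r (proj_ket psi)).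

Definition pure_decomposition (R : realType) (T : finType) (rho : op R T)
    (k : nat) (p : 'I_k -> R) (psi : 'I_k -> ket R T) : Prop :=
  [/\ forall i, 0 <= p i,
      \sum_(i < k) p i = 1,
      forall i, unit_ket (psi i)
    & rho = \sum_(i < k) (p i)%:C%C *: proj_ket (psi i)].

Definition average_ents (R : realType) (A B : finType) (alpha : R)
    (rho : op R (A * B)%type) : set R :=
  [set e | exists (k : nat) (p : 'I_k -> R) (psi : 'I_k -> ket R (A * B)%type),
     pure_decomposition rho p psi /\
     e = \sum_(i < k) p i * pure_renyi_ent alpha (psi i)].

(* The minimum over all finite pure state decompositions is written as an
   infimum. For alpha > 1 and a density operator rho, the set is nonempty
   (spectral decomposition) and bounded below by 0, and its infimum is attained
   (Caratheodory and compactness); renyi_ent_min identifies it with the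
   minimum. *)
Definition renyi_ent (R : realType) (A B : finType) (alpha : R)
    (rho : op R (A * B)%type) : R :=
  inf (average_ents alpha rho).

Lemma renyi_ent_min (R : realType) (A B : finType) (alpha : R)
    (rho : op R (A * B)%type) (m : R) :
  average_ents alpha rho m -> lbound (average_ents alpha rho) m ->
  renyi_ent alpha rho = m.
Proof.
move=> Sm lbm; apply/eqP; rewrite eq_le /renyi_ent; apply/andP; split.
  by apply: ge_inf => //; exists m.
by apply: lb_le_inf => //; exists m.
Qed.

Definition config (n : nat) : finType := {ffun 'I_n -> 'I_2}.

(* Qubit k in state a, the other n.-1 qubits, in increasing order, in x. *)
Definition join_config (n : nat) (k : 'I_n) (a : 'I_2) (x : config n.-1) :
    config n :=
  [ffun i => if unlift k i is Some j then x j else a].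

(* rho regarded as a bipartite state on C^2 (x) (C^2)^{(x) n.-1}, the first
   factor being qubit k. *)
Definition cut_state (R : realType) (n : nat) (k : 'I_n)
    (rho : op R (config n)) : op R ('I_2 * config n.-1)%type :=
  mkop (fun s t => entry rho (join_config k s.1 s.2) (join_config k t.1 t.2)).

(* Partial trace over all qubits other than i and j, for i != j: the row and
   column configurations agree on every traced-out qubit. *)
Definition reduced_state (R : realType) (n : nat) (i j : 'I_n)
    (rho : op R (config n)) : op R ('I_2 * 'I_2)%type :=
  mkop (fun s t =>
    \sum_(f : config n | (f i, f j) == s)
      \sum_(g : config n | ((g i, g j) == t) &&
                           [forall k, (k \notin [:: i; j]) ==> (f k == g k)])
        entry rho f g).

Definition first_qubit (n : nat) (hn : (1 < n)%N) : 'I_n := Ordinal (ltnW hn).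

(* Main.v *)
Require Import Defs.
From mathcomp Require Import all_boot all_order all_algebra.
From mathcomp Require Import all_classical all_reals all_analysis.
From mathcomp Require Import complex ring lra.

(* The entropy of a qubit of determinant x / 4 is qubit_renyi alpha x, which for
   alpha >= 2 is nondecreasing and superadditive in x (it is convex and vanishes
   at 0).  So it suffices to bound, for a pure state, the sum of the squared
   concurrences of the two-qubit marginals by 4 det rho_A1, in the form: each
   marginal has a decomposition all of whose members have concurrence at most
   2 c_j, with sum_j c_j^2 <= det rho_A1.  Averaging over a decomposition of rho
   then gives the mixed case.

   The qubits A2, ..., An are measured one after the other, and the bounds for
   the two outcomes recombine by Minkowski's inequality.  If a Takagi
   factorisation writes rho_A1Aj as a sum of |v_k><v_k| with det v_k = l_k >= 0
   and the v_k orthogonal for the polar form of det, then rho_A1Aj has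
   decompositions of average |det| equal to c_j = max(0, l_0 - sum_(k>0) l_k),
   and there is an orthonormal basis of Aj whose two outcomes have unnormalised
   A1-marginals P, Q with
       (sqrt (det P) + sqrt (det Q))^2 + c_j^2 <= det rho_A1.
   To see this, write v_k = v_0 u_k: the u_k with k > 0 are traceless, and in a
   basis of Aj where the sum of the u_k^* u_k is diagonal one of the operators
   K = sigma_x, sigma_y, of eigenvalues 1 and -1, has
   - det (sum_k v_k K v_k^* ) >= c_j^2; its eigenbasis works because
   det (P + Q) + det (P - Q) = 2 (det P + det Q). *)

Set Implicit Arguments.
Unset Strict Implicit.
Unset Printing Implicit Defensive.

Import Order.TTheory GRing.Theory Num.Theory.
Import numFieldNormedType.Exports.
Local Open Scope classical_set_scope.
Local Open Scope ring_scope.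
Local Open Scope sesquilinear_scope.

(** * The entropy of a qubit *)

(** The threshold 2 for alpha comes from the derivative of [lnsum], which is governed by tanh s /
    tanh (b s) with b = alpha - 1; this ratio is nondecreasing in s when b >= 1.

    A bound on the average concurrence of a marginal would not suffice: the entropy is a convex
    function of the concurrence, so its average over a decomposition can exceed its value at the
    average. Hence the bound on every single member, reached by rotating a decomposition until |det|
    is proportional to the weight. The induction over the qubits, on the other hand, carries only
    sums of |det|, because these add when the decompositions for the two outcomes are concatenated.
    The uniform bound is restored once, after the induction, by [equal_concurrence]; the lower bound
    in [takagi_family] ensures that nothing is lost there. *)

Section QubitRenyi.
Variable R : realType.
Implicit Types (a b s t u y z : R).

(* With y = exp v this says that b sinh v <= sinh (b v). *)
Lemma powR_sub_powRN_ge b y : 1 <= b -> 1 <= y ->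
  b * (y - y^-1) <= y `^ b - y `^ (- b).
Proof.
move=> b1 y1.
pose f : R -> R := (fun z : R => z `^ b - z `^ (- b)) - (fun z : R => b * (z - z^-1)).
pose df (z : R) : R := b * z `^ (b - 1) - (- b) * z `^ (- b - 1) - b * (1 + z^-2).
have fE (z : R) : f z = z `^ b - z `^ (- b) - b * (z - z^-1) by [].
have dfP (z : R) : 0 < z -> is_derive z 1 f (df z).
  move=> z0; rewrite /f /df; apply: is_deriveB; first by apply: is_deriveB; apply: is_derive1_powR.
  have -> : (fun z0 : R => b * (z0 - z0^-1)) = b \*: (id - (fun z : R => z^-1)) by [].
  have -> : b * (1 + z^-2) = b *: (1 - (- z ^- 2 *: 1)).
    by rewrite /GRing.scale /= mulr1 opprK.
  apply: is_deriveZ; apply: is_deriveB; apply: is_deriveV => //.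
  by rewrite gt_eqF.
suff : f 1 <= f y by rewrite !fE !powR1 invr1 !subrr mulr0 subr0 subr_ge0.
have [->//|ny1] := eqVneq y 1.
have y1' : 1 < y by rewrite lt_neqAle eq_sym ny1.
apply: (@ger0_derive1_ndecr _ f 1 y) => //.
- by move=> z; rewrite in_itv /= => /andP[z1 _]; have [] := dfP z (lt_trans ltr01 z1).
- move=> z; rewrite in_itv /= => /andP[z1 _]; have z0 := lt_trans ltr01 z1.
  rewrite derive1E; have [_ ->] := dfP z z0; rewrite /df.
  have -> : z `^ (b - 1) = z `^ b / z by rewrite powRB ?powRr1 ?(ltW z0) ?(gt_eqF z0) ?implybT.
  have -> : z `^ (- b - 1) = (z `^ b)^-1 / z.
    by rewrite powRB ?powRr1 ?(ltW z0) ?powRN ?(gt_eqF z0) ?implybT.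
  have w1 : z <= z `^ b by apply: le1r_powR => //; exact: ltW.
  set w := z `^ b in w1 *; have w0 : 0 < w by exact: lt_le_trans w1.
  (* With w = z^b >= z >= 1 the derivative splits into nonnegative factors. *)
  have -> : b * (w / z) - - b * (w^-1 / z) - b * (1 + z ^- 2) =
     b * ((w - z) * (w * z - 1)) / (w * z ^+ 2).
    by field; rewrite ?gt_eqF.
  apply: divr_ge0; last by rewrite mulr_ge0 ?exprn_ge0 // ltW.
  apply: mulr_ge0; first lra.
  apply: mulr_ge0; first lra.
  rewrite subr_ge0; apply: le_trans (_ : w * 1 <= _); first by lra.
  by rewrite ler_wpM2l ?ltW.
- apply: derivable_within_continuous => z; rewrite in_itv /= => /andP[z1 _].
  by have [] := dfP z (lt_le_trans ltr01 z1).
Qed.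

Lemma is_derive_powR1D b t : -1 < t ->
  is_derive t 1 (fun s : R => (1 + s) `^ b) (b * (1 + t) `^ (b - 1)).
Proof.
move=> t1; rewrite -[X in is_derive _ _ _ X]mulr1.
apply: (@is_derive1_comp _ (fun z => z `^ b) (fun s => 1 + s)).
  by apply: is_derive1_powR; lra.
have -> : (fun s : R => 1 + s) = cst 1 + id by [].
by apply: is_derive_eq; rewrite add0r.
Qed.

Lemma is_derive_powR1B b t : t < 1 ->
  is_derive t 1 (fun s : R => (1 - s) `^ b) (- (b * (1 - t) `^ (b - 1))).
Proof.
move=> t1; rewrite -[X in is_derive _ _ _ X]mulrN1.
apply: (@is_derive1_comp _ (fun z => z `^ b) (fun s => 1 - s)).
  by apply: is_derive1_powR; lra.
have -> : (fun s : R => 1 - s) = cst 1 - id by [].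
by apply: is_derive_eq; rewrite sub0r.
Qed.

Lemma powRB1 b z : 0 < z -> z `^ (b - 1) = z `^ b / z.
Proof. by move=> z0; rewrite powRB ?powRr1 ?(ltW z0) ?(gt_eqF z0) ?implybT. Qed.

(* For t = tanh s this is tanh s / tanh (b s). *)
Definition tanh_ratio b t :=
  t * ((1 + t) `^ b + (1 - t) `^ b) / ((1 + t) `^ b - (1 - t) `^ b).

Lemma tanh_ratio_den b t : 0 < b -> 0 < t < 1 ->
  0 < (1 - t) `^ b < (1 + t) `^ b.
Proof.
move=> b0 /andP[t0 t1]; apply/andP; split; first by apply: powR_gt0; lra.
by apply: gt0_ltr_powR => //; rewrite ?nnegrE; lra.
Qed.

(** Up to a positive factor the derivative at z is y^b - y^-b - b (y - 1/y) with y = (1 + z) / (1 -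
    z) >= 1, so [powR_sub_powRN_ge] gives its sign. *)
Lemma tanh_ratio_homo b s t : 1 <= b -> 0 < s -> s <= t -> t < 1 ->
  tanh_ratio b s <= tanh_ratio b t.
Proof.
move=> b1 s0 st t1.
pose N := id * ((fun z : R => (1 + z) `^ b) + (fun z : R => (1 - z) `^ b)) : R -> R.
pose D := ((fun z : R => (1 + z) `^ b) - (fun z : R => (1 - z) `^ b)) : R -> R.
pose f : R -> R := N * (fun z => (D z)^-1).
have fE (z : R) : tanh_ratio b z = f z by [].
pose dA z : R := b * (1 + z) `^ (b - 1).
pose dB z : R := - (b * (1 - z) `^ (b - 1)).
pose dN z : R := z * (dA z + dB z) + ((1 + z) `^ b + (1 - z) `^ b).
pose df z : R := N z * (- (D z)^-2 * (dA z - dB z)) + (D z)^-1 * dN z.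
have b0 : 0 < b by lra.
have D0 (z : R) : 0 < z < 1 -> 0 < D z.
  by move=> /(tanh_ratio_den b0)/andP[_]; rewrite -subr_gt0.
have dfP (z : R) : 0 < z < 1 -> is_derive z 1 f (df z).
  move=> z01; have [z0 z1] := andP z01.
  have dAP : is_derive z 1 (fun z : R => (1 + z) `^ b) (dA z) by apply: is_derive_powR1D; lra.
  have dBP : is_derive z 1 (fun z : R => (1 - z) `^ b) (dB z) by apply: is_derive_powR1B; lra.
  have dDP : is_derive z 1 D (dA z - dB z) by exact: is_deriveB.
  have dNP : is_derive z 1 N (dN z).
    have -> : dN z = z *: (dA z + dB z) + ((1 + z) `^ b + (1 - z) `^ b) *: 1.
      by rewrite /GRing.scale /= mulr1.
    exact: (@is_deriveM _ _ id ((fun z : R => (1 + z) `^ b) + (fun z : R => (1 - z) `^ b))).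
  apply: (@is_deriveM _ _ N (fun z => (D z)^-1)).
  by apply: is_deriveV; rewrite gt_eqF ?D0.
rewrite !fE.
have [->//|nst] := eqVneq s t.
apply: (@ger0_derive1_ndecr _ f s t) => //.
- move=> z; rewrite in_itv /= => /andP[z1 z2].
  have z01 : 0 < z < 1 by lra.
  by have [] := dfP z z01.
- move=> z; rewrite in_itv /= => /andP[z1 z2].
  have z01 : 0 < z < 1 by lra.
  rewrite derive1E; have [_ ->] := dfP z z01; rewrite /df /dN /dA /dB !powRB1; try lra.
  have Dz := D0 z z01.
  have -> : N z = z * ((1 + z) `^ b + (1 - z) `^ b) by [].
  have := tanh_ratio_den b0 z01.
  have y1 : 1 <= (1 + z) / (1 - z) by rewrite ler_pdivlMr; lra.
  have := powR_sub_powRN_ge b1 y1.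
  have yb : ((1 + z) / (1 - z)) `^ b = (1 + z) `^ b / (1 - z) `^ b.
    rewrite powRM ?invr_ge0; try lra.
    by rewrite -[(1 - z)^-1]powR_inv1 -?powRrM ?mulN1r ?powRN //; lra.
  rewrite powRN yb; move: Dz; have -> : D z = (1 + z) `^ b - (1 - z) `^ b by [].
  set A := (1 + z) `^ b; set B := (1 - z) `^ b.
  move=> AB h /andP[B0 _].
  have A0 : 0 < A by lra.
  have -> : z * (A + B) * (- (A - B) ^- 2 * (b * (A / (1 + z)) - - (b * (B / (1 - z))))) +
     (A - B)^-1 * (z * (b * (A / (1 + z)) + - (b * (B / (1 - z)))) + (A + B)) =
    A * B / (A - B) ^+ 2 * ((A / B - (A / B)^-1) - b * ((1 + z) / (1 - z) - ((1 + z) / (1 - z))^-1)).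
    by field; rewrite ?gt_eqF; lra.
  apply: mulr_ge0; last by lra.
  by rewrite divr_ge0 ?exprn_ge0 ?mulr_ge0 // ltW.
- apply: derivable_within_continuous => z; rewrite in_itv /= => /andP[z1 z2].
  have z01 : 0 < z < 1 by lra.
  by have [] := dfP z z01.
Qed.

(** With u = 1 - 4 det rho, the squared length of the Bloch vector, 1 + sqrt u and 1 - sqrt u are
    twice the eigenvalues of rho; so this is ln (tr rho^a) + a ln 2. Convexity of the entropy in the
    determinant is concavity of this function in u. *)
Definition lnsum a u := ln ((1 + Num.sqrt u) `^ a + (1 - Num.sqrt u) `^ a).

Lemma powR_sum_gt0 a t : 0 <= t <= 1 -> 0 < (1 + t) `^ a + (1 - t) `^ a.
Proof. by move=> /andP[t0 t1]; apply: ltr_wpDr; rewrite ?powR_ge0 ?powR_gt0 //; lra. Qed.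

Lemma sqrt_itv01o u : 0 <= u < 1 -> 0 <= Num.sqrt u < 1.
Proof. by move=> /andP[u0 u1]; rewrite sqrtr_ge0 -[X in _ < X]sqrtr1 ltr_sqrt. Qed.

(** Splitting (1 + t)^a as (1 + t) (1 + t)^(a - 1), and likewise for 1 - t, brings the quotient into
    the form of a constant over a sum of two nondecreasing functions of u. This is where the
    exponent a - 1 arises. *)
Lemma is_derive_lnsum a u : 2 <= a -> 0 < u < 1 ->
  is_derive u 1 (lnsum a) (a / 2 / (u + tanh_ratio (a - 1) (Num.sqrt u))).
Proof.
move=> a2 /andP[u0 u1].
have /andP[_ t1] : 0 <= Num.sqrt u < 1 by apply: sqrt_itv01o; lra.
have t0 : 0 < Num.sqrt u by rewrite sqrtr_gt0.
pose P : R -> R := (fun z : R => (1 + z) `^ a) + (fun z : R => (1 - z) `^ a).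
have PE z : P z = (1 + z) `^ a + (1 - z) `^ a by [].
have dP : is_derive (Num.sqrt u) 1 P
    (a * (1 + Num.sqrt u) `^ (a - 1) - a * (1 - Num.sqrt u) `^ (a - 1)).
  apply: is_deriveD; first by apply: is_derive_powR1D; lra.
  by apply: is_derive_powR1B; lra.
have P0 : 0 < P (Num.sqrt u) by rewrite PE; apply: powR_sum_gt0; lra.
have dlnP : is_derive (Num.sqrt u) 1 (@ln R \o P)
    ((P (Num.sqrt u))^-1 * (a * (1 + Num.sqrt u) `^ (a - 1) - a * (1 - Num.sqrt u) `^ (a - 1))).
  by apply: is_derive1_comp => //; apply: is_derive1_ln.
have := @is_derive1_comp _ (@ln R \o P) Num.sqrt u _ _ dlnP (is_derive1_sqrt u0).
congr (is_derive _ _ _ _).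
rewrite PE /tanh_ratio.
have ut : u = Num.sqrt u ^+ 2 by rewrite sqr_sqrtr ?(ltW u0).
set t := Num.sqrt u in t0 t1 ut *; rewrite [in RHS]ut.
have /andP[B0 AB] : 0 < (1 - t) `^ (a - 1) < (1 + t) `^ (a - 1).
  by apply: tanh_ratio_den; lra.
rewrite -[(1 + t) `^ a](mulr_powRB1 (x := 1 + t)) -?[(1 - t) `^ a](mulr_powRB1 (x := 1 - t)); try lra.
set A := (1 + t) `^ (a - 1) in AB *; set B := (1 - t) `^ (a - 1) in B0 AB *.
have tA : 0 < t * A by apply: mulr_gt0; lra.
have tB : 0 < t * B by apply: mulr_gt0; lra.
have tAB : 0 < t * (A - B) by rewrite !mulr_gt0 //; lra.
have ttAB : 0 < t * (t * (A - B)) by rewrite !mulr_gt0 //; lra.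
field; rewrite !gt_eqF //; try lra.
Qed.

Lemma div_antitone (c p q : R) : 0 <= c -> 0 < p -> p <= q -> c / q <= c / p.
Proof.
move=> c0 p0 pq; rewrite ler_wpM2l // lef_pV2 // posrE.
exact: lt_le_trans pq.
Qed.

Lemma tanh_ratio_sqrt_gt0 a u : 2 <= a -> 0 < u < 1 -> 0 < tanh_ratio (a - 1) (Num.sqrt u).
Proof.
move=> a2 /andP[u0 u1].
have /andP[_ t1] : 0 <= Num.sqrt u < 1 by apply: sqrt_itv01o; rewrite ltW.
have t0 : 0 < Num.sqrt u by rewrite sqrtr_gt0.
have /andP[B0 AB] : 0 < (1 - Num.sqrt u) `^ (a - 1) < (1 + Num.sqrt u) `^ (a - 1).
  by apply: tanh_ratio_den; rewrite ?t0 //; lra.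
rewrite /tanh_ratio; move: t0 B0 AB; set t := Num.sqrt u; set A := (1 + t) `^ _; set B := (1 - t) `^ _.
by move=> t0 B0 AB; rewrite divr_gt0 ?mulr_gt0 ?subr_gt0 ?addr_gt0 // (lt_trans B0).
Qed.

Lemma lnsum_derive_homo a u v : 2 <= a -> 0 < u -> u <= v -> v < 1 ->
  a / 2 / (v + tanh_ratio (a - 1) (Num.sqrt v)) <=
  a / 2 / (u + tanh_ratio (a - 1) (Num.sqrt u)).
Proof.
move=> a2 u0 uv v1.
have h : tanh_ratio (a - 1) (Num.sqrt u) <= tanh_ratio (a - 1) (Num.sqrt v).
  apply: tanh_ratio_homo; rewrite ?sqrtr_gt0 //; [lra | by rewrite ler_sqrt; lra |].
  by have /andP[_ ->] : 0 <= Num.sqrt v < 1 by apply: sqrt_itv01o; lra.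
have hu : 0 < tanh_ratio (a - 1) (Num.sqrt u).
  by apply: tanh_ratio_sqrt_gt0; rewrite // u0 (le_lt_trans uv).
move: (tanh_ratio _ (Num.sqrt u)) (tanh_ratio _ (Num.sqrt v)) h hu => p q h hu.
by apply: div_antitone; lra.
Qed.

Lemma lnsum_continuous_at a u : 0 <= u < 1 -> {for u, continuous (lnsum a)}.
Proof.
move=> u01; have t01 := sqrt_itv01o u01.
have -> : lnsum a =
    (@ln R \o ((fun z : R => (1 + z) `^ a) + (fun z : R => (1 - z) `^ a))) \o Num.sqrt by [].
apply: continuous_comp; first exact: sqrt_continuous.
apply: continuous_comp; last by apply: continuous_ln; apply: powR_sum_gt0; lra.
apply: differentiable_continuous; apply/derivable1_diffP; apply: derivableD.
  by have [] // := @is_derive_powR1D a (Num.sqrt u) _; lra.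
by have [] // := @is_derive_powR1B a (Num.sqrt u) _; lra.
Qed.

Lemma lnsum_cvg_left1 a : 2 <= a -> (lnsum a @ 1^'- --> lnsum a 1)%classic.
Proof.
move=> a2.
have sc : ((fun u : R => Num.sqrt u) @ 1^'- --> (1 : R))%classic.
  apply: cvg_at_left_filter; rewrite -[X in (_ --> X)%classic]sqrtr1.
  exact: sqrt_continuous.
have B : ((fun u : R => (1 - Num.sqrt u) `^ a) @ 1^'- --> (0 : R))%classic.
  apply: (@squeeze_cvgr _ _ _ _ (cst 0) (fun u : R => 1 - Num.sqrt u)).
  - near=> u; rewrite powR_ge0 /=.
    have u0 : 0 < u by near: u; exact: nbhs_left_gt.
    have u1 : u < 1 by near: u; exact: nbhs_left_lt.
    have /andP[? ?] : 0 <= Num.sqrt u < 1 by apply: sqrt_itv01o; lra.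
    by apply: ge1r_powR; lra.
  - exact: cvg_cst.
  - by rewrite -[X in (_ --> X)%classic](subrr 1); apply: cvgB => //; exact: cvg_cst.
have A : ((fun u : R => (1 + Num.sqrt u) `^ a) @ 1^'- --> ((1 + 1) `^ a : R))%classic.
  apply: (@cvg_comp _ _ _ Num.sqrt (fun z : R => (1 + z) `^ a)); first exact: sc.
  have : {for (1 : R), continuous (fun z : R => (1 + z) `^ a)}; last by [].
  apply: differentiable_continuous; apply/derivable1_diffP.
  by have [] // := @is_derive_powR1D a 1 _; lra.
rewrite {2}/lnsum sqrtr1 subrr powR0; last by rewrite gt_eqF; lra.
apply: (@cvg_comp _ _ _ (fun u : R => (1 + Num.sqrt u) `^ a + (1 - Num.sqrt u) `^ a) (@ln R)).
  by apply: cvgD; [exact: A | exact: B].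
by apply: continuous_ln; rewrite addr0 powR_gt0; lra.
Unshelve. all: by end_near. Qed.

Lemma lnsum_within a u v : 2 <= a -> 0 <= u -> u < v -> v <= 1 ->
  {within `[u, v], continuous (lnsum a)}.
Proof.
move=> a2 u0 uv v1; apply/continuous_within_itvP => //; split.
- by move=> z; rewrite in_itv /= => /andP[z1 z2]; apply: lnsum_continuous_at; lra.
- by apply: cvg_at_right_filter; apply: lnsum_continuous_at; lra.
- move: v1; rewrite le_eqVlt => /predU1P[->|v1]; first exact: lnsum_cvg_left1.
  by apply: cvg_at_left_filter; apply: lnsum_continuous_at; lra.
Qed.

(** Concavity is used in mean value form, which asks for a derivative on the open interval only and
    so includes the ends 0, where the square root is not differentiable, and 1. *)
Lemma lnsum_MVT a u v : 2 <= a -> 0 <= u -> u < v -> v <= 1 ->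
  exists2 c, u < c < v &
    lnsum a v - lnsum a u = a / 2 / (c + tanh_ratio (a - 1) (Num.sqrt c)) * (v - u).
Proof.
move=> a2 u0 uv v1.
pose df (z : R) := a / 2 / (z + tanh_ratio (a - 1) (Num.sqrt z)).
have D z : z \in `]u, v[ -> is_derive z 1 (lnsum a) (df z).
  by rewrite in_itv /= => /andP[z1 z2]; apply: is_derive_lnsum; lra.
have [c] := MVT uv D (lnsum_within a2 u0 uv v1).
by rewrite in_itv /= => cuv ->; exists c.
Qed.

Lemma lnsum_homo a u v : 2 <= a -> 0 <= u -> u <= v -> v <= 1 -> lnsum a u <= lnsum a v.
Proof.
move=> a2 u0; rewrite le_eqVlt => /predU1P[->//|uv] v1.
have [c /andP[uc cv] h] := lnsum_MVT a2 u0 uv v1.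
have u1 : 0 < c by exact: le_lt_trans uc.
have c1 : c < 1 by exact: lt_le_trans v1.
have tr0 : 0 < tanh_ratio (a - 1) (Num.sqrt c) by apply: tanh_ratio_sqrt_gt0; rewrite // u1.
rewrite -subr_ge0 h; move: (tanh_ratio _ _) tr0 {h} => p p0.
by apply: mulr_ge0; [apply: divr_ge0; lra | lra].
Qed.

(** By symmetry y <= x. The intervals [1 - (x + y), 1 - x] and [1 - y, 1] both have length y and the
    second lies to the right of the first, so f grows less on it. *)
Lemma concave_four_points (f df : R -> R) :
  (forall u v, 0 <= u -> u < v -> v <= 1 ->
    exists2 c, u < c < v & f v - f u = df c * (v - u)) ->
  (forall u v, 0 < u -> u <= v -> v < 1 -> df v <= df u) ->
  forall x y, 0 <= x -> 0 <= y -> x + y <= 1 -> f 1 + f (1 - (x + y)) <= f (1 - x) + f (1 - y).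
Proof.
move=> mvt anti x y; wlog yx : x y / y <= x.
  move=> H x0 y0 xy; have [yx|/ltW yx] := leP y x; first exact: H.
  have := H y x yx y0 x0; rewrite (addrC y x) => /(_ xy) h.
  by rewrite (addrC (f (1 - x))).
move=> x0; rewrite le_eqVlt => /predU1P[<-|y0] xy; first by rewrite addr0 subr0 addrC.
have [|||c /andP[c1 c2] hc] := mvt (1 - (x + y)) (1 - x); try lra.
have [|||d /andP[d1 d2] hd] := mvt (1 - y) 1; try lra.
have h : df d <= df c by apply: anti; lra.
have : f 1 - f (1 - y) <= f (1 - x) - f (1 - (x + y)).
  rewrite hc hd; have -> : 1 - (1 - y) = y by ring.
  have -> : 1 - x - (1 - (x + y)) = y by ring.
  by rewrite ler_wpM2r // ltW.
by lra.
Qed.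

Lemma lnsum_concave4 a x y : 2 <= a -> 0 <= x -> 0 <= y -> x + y <= 1 ->
  lnsum a 1 + lnsum a (1 - (x + y)) <= lnsum a (1 - x) + lnsum a (1 - y).
Proof.
move=> a2; apply: concave_four_points (fun u v => @lnsum_MVT a u v a2) _ x y => u v.
exact: lnsum_derive_homo.
Qed.

(* The entropy of a qubit with determinant x / 4, whose eigenvalues are
   (1 + sqrt (1 - x)) / 2 and (1 - sqrt (1 - x)) / 2. *)
Definition qubit_renyi a x := (lnsum a 1 - lnsum a (1 - x)) / ((a - 1) * ln 2).

Lemma qubit_renyi_den a : 2 <= a -> 0 < (a - 1) * ln 2.
Proof. by move=> a2; rewrite mulr_gt0 ?ln_gt0 //; lra. Qed.

Lemma qubit_renyi_homo a x y : 2 <= a -> 0 <= x -> x <= y -> y <= 1 ->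
  qubit_renyi a x <= qubit_renyi a y.
Proof.
move=> a2 x0 xy y1; rewrite /qubit_renyi.
have : lnsum a (1 - y) <= lnsum a (1 - x) by apply: lnsum_homo; lra.
move: (lnsum a 1) (lnsum a (1 - x)) (lnsum a (1 - y)) => p q r h.
by rewrite ler_pM2r ?invr_gt0 ?qubit_renyi_den // lerD2l lerN2.
Qed.

Lemma qubit_renyi0 a : qubit_renyi a 0 = 0.
Proof. by rewrite /qubit_renyi subr0 subrr mul0r. Qed.

Lemma qubit_renyi_ge0 a x : 2 <= a -> 0 <= x <= 1 -> 0 <= qubit_renyi a x.
Proof. by move=> a2 /andP[x0 x1]; rewrite -(qubit_renyi0 a) qubit_renyi_homo. Qed.

Lemma qubit_renyiD a x y : 2 <= a -> 0 <= x -> 0 <= y -> x + y <= 1 ->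
  qubit_renyi a x + qubit_renyi a y <= qubit_renyi a (x + y).
Proof.
move=> a2 x0 y0 xy; rewrite /qubit_renyi -mulrDl; have := lnsum_concave4 a2 x0 y0 xy.
move: (lnsum a 1) (lnsum a (1 - x)) (lnsum a (1 - y)) (lnsum _ _) => p q r w h.
by rewrite ler_pM2r ?invr_gt0 ?qubit_renyi_den //; lra.
Qed.

Lemma qubit_renyi_sum (I : Type) (r : seq I) (P : pred I) (F : I -> R) a :
  2 <= a -> (forall i, 0 <= F i) -> \sum_(i <- r | P i) F i <= 1 ->
  \sum_(i <- r | P i) qubit_renyi a (F i) <= qubit_renyi a (\sum_(i <- r | P i) F i).
Proof.
move=> a2 F0; elim: r => [|i r IH]; first by rewrite !big_nil qubit_renyi0.
rewrite !big_cons; case: ifP => // _ h.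
have s0 : 0 <= \sum_(j <- r | P j) F j by exact: sumr_ge0.
have Fi := F0 i; have s1 : \sum_(j <- r | P j) F j <= 1.
  by apply: le_trans h; rewrite lerDr.
exact: le_trans (lerD (lexx _) (IH s1)) (qubit_renyiD a2 Fi s0 h).
Qed.

(** Since p + q = 1, the square root of 1 - 4 p q is |p - q|. Doubling the eigenvalues costs a ln 2,
    which is exactly [lnsum a 1]. *)
Lemma qubit_renyiE a p q : 2 <= a -> 0 <= p -> 0 <= q -> p + q = 1 ->
  (1 - a)^-1 * log2 (p `^ a + q `^ a) = qubit_renyi a (4 * (p * q)).
Proof.
move=> a2; wlog qp : p q / q <= p.
  move=> H p0 q0 pq; have [qp|/ltW qp] := leP q p; first exact: H.
  by rewrite (mulrC p q) (addrC (p `^ a)) H // addrC.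
move=> p0 q0 pq; have pE : p = 1 - q by lra.
have sE : Num.sqrt (1 - 4 * (p * q)) = p - q.
  have -> : 1 - 4 * (p * q) = (p - q) ^+ 2 by rewrite pE; ring.
  by rewrite sqrtr_sqr ger0_norm //; lra.
have two : (2 : R) `^ a != 0 by rewrite gt_eqF ?powR_gt0.
have lE : lnsum a (1 - 4 * (p * q)) = ln (p `^ a + q `^ a) + a * ln 2.
  rewrite /lnsum sE.
  have -> : 1 + (p - q) = p * 2 by lra.
  have -> : 1 - (p - q) = q * 2 by lra.
  rewrite !powRM // -mulrDl lnM ?posrE ?powR_gt0 // ?ln_powR //.
  by rewrite ltr_wpDr ?powR_ge0 // powR_gt0; lra.
have l1 : lnsum a 1 = a * ln 2.
  by rewrite /lnsum sqrtr1 subrr powR0 ?addr0 ?ln_powR // gt_eqF //; lra.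
rewrite /qubit_renyi lE l1 /log2.
have : ln 2 != 0 :> R by rewrite gt_eqF // ln_gt0 // ltr1n.
move: (ln (p `^ a + q `^ a)) (ln 2) => w l l0 {lE l1 sE two}.
have a1 : a - 1 != 0 by rewrite gt_eqF //; lra.
have a1' : 1 - a != 0 by rewrite lt_eqF //; lra.
by field; rewrite l0 a1 a1'.
Qed.

End QubitRenyi.

(** * Takagi factorisation *)

Section Takagi.
Local Notation conjm := (map_mx (@Num.conj _)).
Variable C : numClosedFieldType.

(** Gram-Schmidt on the matrix all of whose rows are u: [schmidt] returns a unitary matrix whatever
    the rank of its argument, and its first row spans the line of u. *)
Lemma unitarymx_row0 n (u : 'rV[C]_n.+1) : u != 0 ->
  exists2 S : 'M[C]_n.+1, S \is unitarymx & exists c, row 0 S = c *: u.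
Proof.
move=> u0; pose S := schmidt (\matrix_(i < n.+1) u).
exists S; first exact: schmidt_unitarymx.
have := row_schmidt_sub (\matrix_(i < n.+1) u) 0.
rewrite rowK (big_pred1 0); last by move=> k /=; rewrite leqn0.
rewrite genmxE => /sub_rVP[c uE]; exists c^-1; rewrite uE scalerA mulVf ?scale1r //.
by apply: contraNneq u0 => c0; rewrite uE c0 scale0r.
Qed.

(* A coneigenvector: if v is an eigenvector of A A^* with eigenvalue l^2 >= 0,
   then conj (v A) + l v works, unless it vanishes, in which case 'i v does. *)
Lemma coneigenvector n (A : 'M[C]_n.+1) : A^T = A ->
  exists2 u : 'rV[C]_n.+1, u != 0 & exists l, u *m A = l *: conjm u.
Proof.
move=> Asym; have [m /eigenvalueP[v vA v0]] := eigenvalue_closed (A *m conjm A) (ltn0Sn n).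
pose l := sqrtC m.
have dE (x : 'rV[C]_n.+1) : 0 <= (x *m x ^t*) 0 0 ?= iff (x == 0).
  rewrite -dotmxE; split; first exact: dnorm_ge0.
  by rewrite eq_sym dnorm_eq0.
(* The conjugate of a symmetric A is its adjoint, so m |v|^2 = |v A|^2. *)
have m0 : 0 <= m.
  have : m * (v *m v ^t*) 0 0 = ((v *m A) *m (v *m A) ^t*) 0 0.
    rewrite trmx_mul map_mxM Asym mulmxA -[v *m A *m _]mulmxA vA.
    by rewrite -scalemxAl [RHS]mxE.
  have vv : 0 < (v *m v ^t*) 0 0 by rewrite lt_neqAle (dE v).2 v0 dE.
  by move=> h; rewrite -(pmulr_lge0 _ vv) h dE.
have lE : l * l = m by rewrite -expr2 sqrtCK.
have l_real : l^* = l by apply/CrealP/ger0_real; rewrite sqrtC_ge0.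
have cZ k a (x : 'rV[C]_k) : conjm (a *: x) = a^* *: conjm x.
  by apply/matrixP=> i j; rewrite !mxE rmorphM.
have cK k (x : 'rV[C]_k) : conjm (conjm x) = x by apply/matrixP=> i j; rewrite !mxE conjCK.
pose w := conjm (v *m A) + l *: v.
have wc : conjm w = v *m A + l *: conjm v.
  by rewrite /w map_mxD cZ cK l_real.
have wA : w *m A = l *: conjm w.
  rewrite wc mulmxDl scalerDr -scalemxAl addrC; congr (_ + _).
  rewrite -[X in _ *m X = _](_ : conjm (conjm A) = A); last by apply/matrixP=> i j; rewrite !mxE conjCK.
  by rewrite -map_mxM -mulmxA vA cZ scalerA lE; congr (_ *: _); apply/CrealP/ger0_real.
have [w0|w0] := eqVneq w 0; last by exists w => //; exists l.
exists ('i *: v); first by rewrite scaler_eq0 negb_or neq0Ci.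
exists l; rewrite -scalemxAl cZ conjCi scalerA mulrN mulrC -mulNr -scalerA scaleNr -scalerN.
congr (_ *: _); apply/eqP; rewrite -addr_eq0 -wc w0.
by apply/eqP/matrixP=> i j; rewrite !mxE conjC0.
Qed.

(** Let a multiple of a coneigenvector be the first row of a unitary S. The entries (0, j) of S A
    S^T are then multiples of the inner product of rows j and 0 of S, hence vanish for j > 0;
    symmetry clears the first column, and the induction treats the remaining block. *)
Lemma takagi n (A : 'M[C]_n) : A^T = A ->
  exists2 U : 'M[C]_n, U \is unitarymx & is_diag_mx (U *m A *m U^T).
Proof.
elim: n A => [|n IH] A Asym.
  by exists 1%:M; [apply/unitarymxP; rewrite trmx1 map_mx1 mulmx1 | apply/is_diag_mxP => -[]].
have [u u0 [l uA]] := coneigenvector Asym.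
have [S Su [c S0]] := unitarymx_row0 u0.
have SS : S *m S ^t* = 1%:M by exact/unitarymxP.
have [B BD] : exists B : 'M[C]_(1 + n), B = S *m A *m S^T by exists (S *m A *m S^T).
have Bsym : B^T = B by rewrite BD !trmx_mul trmxK Asym mulmxA.
have B0 j : j != 0 -> B 0 j = 0.
  move=> j0; have -> : B 0 j = (row 0 S *m A *m (row j S)^T) 0 0.
    by rewrite -row_mul BD [LHS]mxE [RHS]mxE; apply: eq_bigr => k _; rewrite !mxE.
  rewrite S0 -scalemxAl uA scalerA.
  have : (S *m S ^t*) j 0 = 0 by rewrite SS mxE (negbTE j0).
  have -> : (S *m S ^t*) j 0 = (row j S *m (row 0 S) ^t*) 0 0.
    by rewrite !mxE; apply: eq_bigr => k _; rewrite !mxE.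
  have -> : (row 0 S) ^t* = c^* *: u ^t* by rewrite S0; apply/matrixP=> k k'; rewrite !mxE rmorphM.
  rewrite -scalemxAr mxE => /eqP.
  rewrite mulf_eq0 conjC_eq0 => /orP[/eqP->|/eqP h]; first by rewrite mul0r scale0r mul0mx mxE.
  rewrite -scalemxAl mxE -[_ *m _]trmxK trmx_mul trmxK mxE.
  rewrite (_ : (conjm u)^T = u ^t*) ?h ?mulr0 //; by apply/matrixP=> k k'; rewrite !mxE.
have B0' j : B (lshift n 0) (rshift 1 j) = 0.
  by rewrite (_ : lshift n 0 = 0) ?B0 //; apply/val_inj.
have [|U Uu Ud] := IH (drsubmx B); first by rewrite trmx_drsub Bsym.
pose V : 'M[C]_(1 + n) := block_mx 1%:M 0 0 U.
have Vu : V \is unitarymx.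
  apply/unitarymxP; rewrite /V tr_block_mx map_block_mx mulmx_block !trmx0 !map_mx0 trmx1 map_mx1.
  by rewrite !(mulmx1, mul1mx, mulmx0, mul0mx, addr0, add0r) (unitarymxP _) // -scalar_mx_block.
have BE : B = block_mx (ulsubmx B) 0 0 (drsubmx B).
  rewrite -[LHS]submxK; congr block_mx.
    by apply/matrixP => i j; rewrite !mxE ord1 B0'.
  by apply/matrixP => i j; rewrite !mxE ord1 -{1}Bsym mxE B0'.
have VBV : is_diag_mx (V *m B *m V^T).
  rewrite BE /V tr_block_mx !trmx0 trmx1 !mulmx_block !(mulmx1, mul1mx, mulmx0, mul0mx, addr0, add0r).
  apply/is_diag_mxP => i j ij; rewrite !mxE.
  case: splitP => i' ie; rewrite !mxE; case: splitP => j' je; try by rewrite mxE.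
    by move: ij; rewrite ie je !ord1.
  have ij' : i' != j' :> nat by apply: contra_neq ij => h; rewrite ie je h.
  by move/is_diag_mxP: Ud => /(_ i' j' ij'); rewrite !mxE.
exists (V *m (S : 'M[C]_(1 + n))); first by rewrite mul_unitarymx.
by move: VBV; rewrite BD trmx_mul !mulmxA.
Qed.
End Takagi.

(** * Decompositions of two-qubit states *)

Section Families.
Variable R : realType.
Local Notation C := R[i].
Local Notation M2 := 'M[C]_2.
Implicit Types (x y z : M2) (s t : seq M2) (h : M2 -> R).

(** The norm of [R[i]] takes its values in [R[i]]; this is the same modulus as an element of R,
    where the inequalities live. *)
Definition cabs (w : C) : R := Num.sqrt (complex.Re w ^+ 2 + complex.Im w ^+ 2).

Lemma cabsE (w : C) : `|w| = (cabs w)%:C%C.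
Proof. exact: normc_def. Qed.

Lemma cabs_ge0 w : 0 <= cabs w. Proof. exact: sqrtr_ge0. Qed.

Lemma cabsM v w : cabs (v * w) = cabs v * cabs w.
Proof. by apply: (@complexI R); rewrite rmorphM /= -!cabsE normrM. Qed.

Lemma cabsD v w : cabs (v + w) <= cabs v + cabs w.
Proof. by rewrite -lecR rmorphD /= -!cabsE ler_normD. Qed.

Lemma cabsN w : cabs (- w) = cabs w.
Proof. by apply: (@complexI R); rewrite -!cabsE normrN. Qed.

Lemma cabsJ w : cabs w^* = cabs w.
Proof. by apply: (@complexI R); rewrite -!cabsE norm_conjC. Qed.

Lemma cabs_sum (I : Type) (r : seq I) (P : pred I) (F : I -> C) :
  cabs (\sum_(i <- r | P i) F i) <= \sum_(i <- r | P i) cabs (F i).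
Proof.
elim/big_rec2: _ => [|i u v _ h]; first by rewrite /cabs /= expr0n addr0 sqrtr0.
by apply: le_trans (cabsD _ _) _; rewrite lerD2l.
Qed.

Lemma mulCJ (w : C) : w * w^* = (cabs w ^+ 2)%:C%C.
Proof. by rewrite -normCK cabsE rmorphXn. Qed.

Lemma cabs_eq0 w : (cabs w == 0) = (w == 0).
Proof. by rewrite -[RHS]normr_eq0 cabsE -(inj_eq (@complexI R)). Qed.

Lemma cabs_real (a : R) : cabs a%:C%C = `|a|.
Proof. by rewrite /cabs /= expr0n addr0 sqrtr_sqr. Qed.

Lemma cabs_ge_Re w : complex.Re w <= cabs w.
Proof.
apply: le_trans (ler_norm _) _; rewrite -sqrtr_sqr ler_wsqrtr // lerDl; exact: sqr_ge0.
Qed.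

(* A matrix x stands for the unnormalised two-qubit state sum_(a, b) x a b |ab>,
   whose concurrence is 2 |mdet x|, and gram s for the operator sum_(x in s) |x><x|. *)
Definition mdet x : C := x 0 0 * x 1 1 - x 0 1 * x 1 0.
Definition mpol x y : C :=
  x 0 0 * y 1 1 + x 1 1 * y 0 0 - x 0 1 * y 1 0 - x 1 0 * y 0 1.
Definition weight x : R := \sum_a \sum_b cabs (x a b) ^+ 2.
Definition gram s (a b a' b' : 'I_2) : C := \sum_(x <- s) x a b * (x a' b')^*.
Definition same_gram s t := forall a b a' b', gram s a b a' b' = gram t a b a' b'.

Lemma same_gram_trans s t u : same_gram s t -> same_gram t u -> same_gram s u.
Proof. by move=> h1 h2 a b a' b'; rewrite h1. Qed.

Lemma gram_cat s t a b a' b' : gram (s ++ t) a b a' b' = gram s a b a' b' + gram t a b a' b'.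
Proof. exact: big_cat. Qed.

Lemma gram_scale (w : C) s a b a' b' :
  gram [seq w *: x | x <- s] a b a' b' = w * w^* * gram s a b a' b'.
Proof. by rewrite /gram big_map big_distrr /=; apply: eq_bigr => x _; rewrite !mxE rmorphM; ring. Qed.

Lemma perm_gram s t : perm_eq s t -> same_gram s t.
Proof. by move=> h a b a' b'; exact: perm_big. Qed.

Lemma weight_gram s : (\sum_(x <- s) weight x)%:C%C = \sum_a \sum_b gram s a b a b.
Proof.
rewrite rmorph_sum /= /gram; under [RHS]eq_bigr do rewrite exchange_big /=.
rewrite exchange_big /=; apply: eq_bigr => x _; rewrite /weight rmorph_sum; apply: eq_bigr => a _.
by rewrite rmorph_sum /=; apply: eq_bigr => b _; rewrite mulCJ.
Qed.

Lemma same_gram_weight s t : same_gram s t -> \sum_(x <- s) weight x = \sum_(x <- t) weight x.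
Proof.
move=> h; apply: (@complexI R); rewrite !weight_gram.
by apply: eq_bigr => a _; apply: eq_bigr => b _; exact: h.
Qed.

Lemma weight_ge0 x : 0 <= weight x.
Proof. by apply: sumr_ge0 => a _; apply: sumr_ge0 => b _; exact: sqr_ge0. Qed.

Lemma weight_eq0 x : weight x = 0 -> x = 0.
Proof.
move=> h; apply/matrixP => a b; rewrite mxE; apply/eqP; rewrite -cabs_eq0 -sqrf_eq0.
have /eqP := h; rewrite psumr_eq0; last by move=> i _; apply: sumr_ge0 => j _; exact: sqr_ge0.
move=> /allP/(_ a (mem_index_enum _))/=; rewrite psumr_eq0; last by move=> j _; exact: sqr_ge0.
by move=> /allP/(_ b (mem_index_enum _)).
Qed.

Lemma weight_scale (w : C) x : weight (w *: x) = cabs w ^+ 2 * weight x.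
Proof.
rewrite /weight big_distrr; apply: eq_bigr => a _; rewrite big_distrr; apply: eq_bigr => b _.
by rewrite mxE cabsM exprMn.
Qed.

Lemma mdet_scale (w : C) x : mdet (w *: x) = w ^+ 2 * mdet x.
Proof. by rewrite /mdet !mxE; ring. Qed.

Lemma mpol_scale (v w : C) x y : mpol (v *: x) (w *: y) = v * w * mpol x y.
Proof. by rewrite /mpol !mxE; ring. Qed.

Lemma mpol_scalel (v : C) x y : mpol (v *: x) y = v * mpol x y.
Proof. by rewrite /mpol !mxE; ring. Qed.

Lemma mpolC x y : mpol x y = mpol y x. Proof. by rewrite /mpol; ring. Qed.

Lemma mpolxx x : mpol x x = 2 * mdet x. Proof. by rewrite /mpol /mdet; ring. Qed.

Lemma Im_mpolxx x : complex.Im (mpol x x) = 2 * complex.Im (mdet x).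
Proof. by rewrite mpolxx; case: (mdet x) => a b /=; ring. Qed.

Lemma mpolDl x y z : mpol (x + y) z = mpol x z + mpol y z.
Proof. by rewrite /mpol !mxE; ring. Qed.

(** Only real coefficients are considered, since only real rotations are applied. This covers both
    the real part of the complex form [mdet] and the Hermitian form [weight]. *)
Definition quadratic h := forall x y, exists k : R, forall c d : R,
  h (c%:C%C *: x + d%:C%C *: y) = c ^+ 2 * h x + c * d * k + d ^+ 2 * h y.

Lemma quadratic_mdet : quadratic (fun x => complex.Re (mdet x)).
Proof.
move=> x y; exists (complex.Re (mpol x y)) => c d.
have -> : mdet (c%:C%C *: x + d%:C%C *: y) =
   (c ^+ 2)%:C%C * mdet x + (c * d)%:C%C * mpol x y + (d ^+ 2)%:C%C * mdet y.
  by rewrite /mdet /mpol !mxE !rmorphXn rmorphM /=; ring.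
by case: (mdet x) (mpol x y) (mdet y) => [? ?] [? ?] [? ?] /=; ring.
Qed.

Lemma quadratic_cabs (a b : 'I_2) : quadratic (fun x => cabs (x a b) ^+ 2).
Proof.
move=> x y; exists (2 * complex.Re (x a b * (y a b)^*)) => c d.
rewrite /cabs !sqr_sqrtr ?addr_ge0 ?sqr_ge0 // !mxE.
by case: (x a b) (y a b) => [? ?] [? ?] /=; ring.
Qed.

Lemma quadraticD h1 h2 : quadratic h1 -> quadratic h2 -> quadratic (fun x => h1 x + h2 x).
Proof.
move=> q1 q2 x y; have [k1 e1] := q1 x y; have [k2 e2] := q2 x y.
by exists (k1 + k2) => c d; rewrite e1 e2; ring.
Qed.

Lemma quadraticZ (a : R) h : quadratic h -> quadratic (fun x => a * h x).
Proof. by move=> q x y; have [k e] := q x y; exists (a * k) => c d; rewrite e; ring. Qed.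

Lemma quadratic_weight : quadratic weight.
Proof.
move=> x y; have q := quadraticD (quadraticD (quadratic_cabs 0 0) (quadratic_cabs 0 1))
  (quadraticD (quadratic_cabs 1 0) (quadratic_cabs 1 1)).
have [k e] := q x y; exists k => c d; rewrite /weight !big_ord_recl !big_ord0 !addr0.
have -> : lift ord0 ord0 = 1 :> 'I_2 by apply/val_inj.
by rewrite e.
Qed.

(** An indefinite form on a real plane has an isotropic direction, here (1, r) with r a root of h x
    + r k + r^2 h y. A rotation taking it as first axis leaves the whole trace h x + h y to the
    second. *)
Lemma rotate_zero h x y : quadratic h -> 0 < h x -> h y < 0 ->
  exists c d : R, [/\ c ^+ 2 + d ^+ 2 = 1,
     h (c%:C%C *: x + d%:C%C *: y) = 0 &
     h ((- d)%:C%C *: x + c%:C%C *: y) = h x + h y].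
Proof.
move=> q hx hy; have [k e] := q x y.
pose D := k ^+ 2 - 4 * (h x * h y).
have D0 : 0 <= D by rewrite subr_ge0 (le_trans _ (sqr_ge0 k)) // pmulr_rle0 // pmulr_rle0 // ltW.
pose r := (- k + Num.sqrt D) / (2 * h y).
have rE : h x + r * k + r ^+ 2 * h y = 0.
  have DE : Num.sqrt D ^+ 2 = D by rewrite sqr_sqrtr.
  have -> : h x + r * k + r ^+ 2 * h y = (Num.sqrt D ^+ 2 - (k ^+ 2 - 4 * (h x * h y))) / (4 * h y).
    by rewrite /r; field; rewrite lt_eqF.
  by rewrite DE subrr mul0r.
have n0 : 0 < 1 + r ^+ 2 by rewrite ltr_wpDr ?sqr_ge0.
pose c := (Num.sqrt (1 + r ^+ 2))^-1.
have c2 : c ^+ 2 * (1 + r ^+ 2) = 1.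
  by rewrite /c exprVn sqr_sqrtr ?(ltW n0) // mulVf // gt_eqF.
have e1 : h (c%:C%C *: x + (c * r)%:C%C *: y) = 0.
  rewrite e; have -> : c ^+ 2 * h x + c * (c * r) * k + (c * r) ^+ 2 * h y =
     c ^+ 2 * (h x + r * k + r ^+ 2 * h y) by ring.
  by rewrite rE mulr0.
exists c, (c * r); split => //; first by rewrite -c2; ring.
have -> : h x + h y = c ^+ 2 * (1 + r ^+ 2) * (h x + h y) by rewrite c2 mul1r.
move: e1; rewrite !e => e1; apply/eqP; rewrite -subr_eq0 -oppr_eq0 -e1; apply/eqP; ring.
Qed.

Lemma rotate_gram (c d : R) x y s : c ^+ 2 + d ^+ 2 = 1 ->
  same_gram [:: c%:C%C *: x + d%:C%C *: y, (- d)%:C%C *: x + c%:C%C *: y & s] [:: x, y & s].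
Proof.
move=> cd a b a' b'; rewrite /gram !big_cons !addrA; congr (_ + _).
have lJ (e f : R) : ((e%:C%C *: x + f%:C%C *: y) a' b')^* = e%:C%C * (x a' b')^* + f%:C%C * (y a' b')^*.
  by rewrite !mxE rmorphD !rmorphM; congr (_ * _ + _ * _); exact: conjc_real.
rewrite (lJ c d) (lJ (- d) c) !mxE.
have -> : x a b * (x a' b')^* + y a b * (y a' b')^* =
  (c ^+ 2 + d ^+ 2)%:C%C * (x a b * (x a' b')^* + y a b * (y a' b')^*) by rewrite cd mul1r.
by rewrite rmorphD !rmorphXn /=; ring.
Qed.

(** Real rotations preserve this property, so the determinants of a rotated family remain real and
    are controlled by their real parts. *)
Definition pol_real s := forall x y, x \in s -> y \in s -> complex.Im (mpol x y) = 0.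

Lemma sum_eq0_neg (I : eqType) (r : seq I) (F : I -> R) i :
  \sum_(j <- r) F j = 0 -> i \in r -> 0 < F i -> exists2 j, j \in r & F j < 0.
Proof.
move=> s0 ir Fi; apply/hasP; apply: contraTT Fi => /hasPn h; rewrite -leNgt -s0 (big_rem i) //=.
rewrite lerDl big_seq sumr_ge0 // => j jr.
by rewrite leNgt h //; exact: mem_rem jr.
Qed.

(** This is the argument that rotates a real symmetric matrix of trace zero to one with zero
    diagonal: two members with values of opposite sign are rotated so that one value becomes 0 and
    the other keeps the sum, and the induction goes on without the first. *)
Lemma zero_diagonal h s : quadratic h -> \sum_(x <- s) h x = 0 ->
  exists t, [/\ same_gram t s, forall x, x \in t -> h x = 0 &
    pol_real s -> forall x, x \in t -> complex.Im (mdet x) = 0].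
Proof.
move=> q; have [n] := ubnP (size s); elim: n s => // n IH s sn s0.
have [/allP all0|/allPn[w ws hw]] := boolP (all (fun x => h x == 0) s).
  exists s; split=> // [x /all0/eqP //|pr x xs].
  by have := pr x x xs xs; rewrite Im_mpolxx; lra.
have [x [y [xs ys hx hy]]] : exists x y, [/\ x \in s, y \in s, 0 < h x & h y < 0].
  have [hw0|hw0] := ltP 0 (h w).
    by have [y ys hy] := sum_eq0_neg s0 ws hw0; exists w, y.
  have nw : 0 < - h w by rewrite oppr_gt0 lt_neqAle hw.
  have s0' : \sum_(j <- s) - h j = 0 by rewrite sumrN s0 oppr0.
  have [x xs hx] := sum_eq0_neg s0' ws nw; exists x, w; split=> //; first by rewrite oppr_lt0 in hx.
  by rewrite -oppr_gt0.
have nyx : y != x by apply/eqP=> yx; move: hx hy; rewrite yx => /lt_trans/[apply]; rewrite ltxx.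
have ps : perm_eq s [:: x, y & rem y (rem x s)].
  apply: perm_trans (perm_to_rem xs) _; rewrite perm_cons; apply: perm_to_rem.
  by move: ys; rewrite (perm_mem (perm_to_rem xs)) inE (negbTE nyx).
set r := rem y _ in ps.
have [c [d [cd h0 h1]]] := rotate_zero q hx hy.
set u := _ + _ in h0; set v := _ + _ in h1.
have [||t [tg t0 tp]] := IH (v :: r).
- by move: sn; rewrite (perm_size ps).
- by move: s0; rewrite (perm_big _ ps) /= !big_cons addrA h1.
exists (u :: t); split.
- apply: same_gram_trans (_ : same_gram (u :: v :: r) s).
    by move=> a b a' b'; rewrite /gram big_cons [RHS]big_cons; congr (_ + _); exact: tg.
  apply: same_gram_trans (rotate_gram _ _ _ cd) _ => a b a' b'.
  by rewrite (perm_gram ps).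
- by move=> z; rewrite inE => /predU1P[->|/t0].
move=> pr; have {}pr : pol_real [:: x, y & r].
  by move=> z z' zs zs'; apply: (pr); rewrite (perm_mem ps).
have lin (z z' w' : M2) (e f : R) : complex.Im (mpol z w') = 0 -> complex.Im (mpol z' w') = 0 ->
    complex.Im (mpol (e%:C%C *: z + f%:C%C *: z') w') = 0.
  move=> h2 h3; rewrite mpolDl !mpol_scalel.
  move: h2 h3; case: (mpol z w') => ? ?; case: (mpol z' w') => ? ? /= -> ->.
  by rewrite !mulr0 !mul0r !addr0.
have mx : x \in [:: x, y & r] by rewrite inE eqxx.
have my : y \in [:: x, y & r] by rewrite !inE eqxx orbT.
move=> z; rewrite inE => /predU1P[->|zt].
  suff : complex.Im (mpol u u) = 0.
    by rewrite Im_mpolxx; lra.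
  by apply: (lin); rewrite mpolC; apply: (lin); exact: (pr).
apply: tp => // z1 z2; rewrite !inE => /predU1P[->|z1r] /predU1P[->|z2r].
- by apply: (lin); rewrite mpolC; apply: (lin); exact: (pr).
- by apply: (lin); apply: (pr); rewrite // !inE z2r !orbT.
- by rewrite mpolC; apply: (lin); apply: (pr); rewrite // !inE z1r !orbT.
- by apply: (pr); rewrite !inE ?z1r ?z2r !orbT.
Qed.

Lemma phase (w : C) : exists v : C, v * v^* = 1 /\ 0 <= v ^+ 2 * w.
Proof.
have [->|w0] := eqVneq w 0; first by exists 1; rewrite conjC1 mulr1 mulr0.
exists (sqrtC (w^* / `|w|)).
have nw0 : `|w| != 0 by rewrite normr_eq0.
split; last by rewrite sqrtCK mulrAC [_ * w]mulrC -normCK expr2 mulfK.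
apply/eqP; rewrite -normCK -normrX sqrtCK normrM normfV norm_conjC normr_id mulfV //.
Qed.

Lemma mpol_suml (I : Type) (r : seq I) (P : pred I) (F : I -> M2) y :
  mpol (\sum_(i <- r | P i) F i) y = \sum_(i <- r | P i) mpol (F i) y.
Proof.
elim/big_rec2: _ => [|i u v _ <-]; last by rewrite mpolDl.
by rewrite /mpol !mxE; ring.
Qed.

Lemma mpol_sumr (I : Type) (r : seq I) (P : pred I) (F : I -> M2) y :
  mpol y (\sum_(i <- r | P i) F i) = \sum_(i <- r | P i) mpol y (F i).
Proof. by rewrite mpolC mpol_suml; apply: eq_bigr => i _; rewrite mpolC. Qed.

(** A unitary mixing U of the members keeps the operator and acts by congruence on the symmetric
    matrix of polar values, which Takagi makes diagonal; phases then make the determinants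
    nonnegative. For the last clause the mixing is inverted: det Z_i is the sum over l of the square
    of the conjugate of U_li times det V_l. The triangle inequality, summed over i with unit rows of
    U, isolates any chosen V_k. *)
Lemma takagi_family s : exists V : seq M2,
  [/\ same_gram V s, pairwise (fun x y => mpol x y == 0) V,
      forall x, x \in V -> 0 <= mdet x
    & forall x, x \in V -> 2 * cabs (mdet x) - \sum_(y <- V) cabs (mdet y) <=
                           \sum_(y <- s) cabs (mdet y)].
Proof.
pose m := size s; pose Z (i : 'I_m) := nth 0 s i.
have sumZ (T : nmodType) (F : M2 -> T) : \sum_(x <- s) F x = \sum_i F (Z i).
  by rewrite (big_nth 0) big_mkord.
pose A := \matrix_(i, j) mpol (Z i) (Z j).
have Asym : A^T = A by apply/matrixP => i j; rewrite !mxE mpolC.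
have [U Uu /is_diag_mxP Ud] := takagi Asym.
pose V k := \sum_i U k i *: Z i.
have VV k l : mpol (V k) (V l) = (U *m A *m U^T) k l.
  rewrite /V mpol_suml mxE.
  under [RHS]eq_bigr do rewrite mxE big_distrl /=.
  rewrite exchange_big /=; apply: eq_bigr => i _; rewrite mpol_sumr; apply: eq_bigr => j _.
  by rewrite mpol_scale !mxE; ring.
have [w wP] := choice (fun k : 'I_m => phase (mdet (V k))).
have w1 k : w k * (w k)^* = 1 by have [] := wP k.
have cw k : cabs (w k) = 1.
  apply/eqP; rewrite -(@pexpr_eq1 _ _ 2) ?cabs_ge0 //; apply/eqP/(@complexI R).
  by rewrite -mulCJ w1.
pose W := [seq w k *: V k | k <- enum 'I_m].
have cW k : cabs (mdet (w k *: V k)) = cabs (mdet (V k)).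
  by rewrite mdet_scale cabsM expr2 cabsM cw !mul1r.
have UU : U ^t* *m U = 1%:M by apply: mulmx1C; exact/unitarymxP.
exists W; split.
- move=> a b a' b'; rewrite /gram /W big_map big_enum /= sumZ.
  pose u c d : 'cV[C]_m := \col_i Z i c d.
  have VE k c d : V k c d = (U *m u c d) k 0.
    by rewrite /V summxE mxE; apply: eq_bigr => i _; rewrite !mxE.
  transitivity (((U *m u a' b') ^t* *m (U *m u a b)) 0 0).
    rewrite mxE; apply: eq_bigr => k _; rewrite -VE.
    rewrite [(w k *: V k) a b]mxE [(w k *: V k) a' b']mxE rmorphM /=.
    rewrite [(_ ^t*) 0 k]mxE [(_^T) 0 k]mxE -VE.
    by rewrite mulrACA w1 mul1r mulrC.
  rewrite trmx_mul map_mxM -mulmxA [_ *m (U *m _)]mulmxA UU mul1mx mxE.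
  by apply: eq_bigr => i _; rewrite !mxE mulrC.
- rewrite /W pairwise_map; apply: sub_pairwise (_ : pairwise (fun k l => k != l) (enum 'I_m)).
    by move=> k l kl /=; rewrite mpol_scale VV Ud ?mulr0.
  by rewrite -uniq_pairwise enum_uniq.
- by move=> x /mapP[k _ ->]; rewrite mdet_scale; have [] := wP k.
move=> x /mapP[k _ ->]; rewrite cW /W big_map big_enum /=.
under eq_bigr do rewrite cW.
have detZ i : mdet (Z i) = \sum_l (U l i)^* ^+ 2 * mdet (V l).
  have : A = U ^t* *m (U *m A *m U^T) *m map_mx (@Num.conj _) U.
    rewrite !mulmxA UU mul1mx -mulmxA [U^T *m _](_ : _ = 1%:M) ?mulmx1 //.
    by rewrite -[LHS](trmxK) trmx_mul trmxK map_trmx UU trmx1.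
  move=> /matrixP/(_ i i); rewrite [LHS]mxE mpolxx [RHS]mxE => h.
  apply: (@mulfI _ 2); first by rewrite pnatr_eq0.
  rewrite h big_distrr; apply: eq_bigr => l _ /=.
  rewrite mxE (bigD1 l) //= big1 => [|l' ll']; last by rewrite Ud // mulr0.
  by rewrite addr0 -VV mpolxx !mxE; ring.
have Uk l : \sum_i cabs (U l i) ^+ 2 = 1.
  have /unitarymxP/matrixP/(_ l l) := Uu; rewrite !mxE eqxx => h.
  apply: (@complexI R); apply: etrans h; rewrite rmorph_sum; apply: eq_bigr => i _ /=.
  by rewrite !mxE mulCJ.
rewrite sumZ.
have -> : 2 * cabs (mdet (V k)) - \sum_l cabs (mdet (V l)) =
   \sum_i (cabs (U k i) ^+ 2 * cabs (mdet (V k)) -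
           \sum_(l | l != k) cabs (U l i) ^+ 2 * cabs (mdet (V l))).
  rewrite sumrB -big_distrl /= Uk mul1r exchange_big /=.
  under [X in _ = _ - X]eq_bigr do rewrite -big_distrl /= Uk mul1r.
  by rewrite (bigD1 k) //=; ring.
apply: ler_sum => i _; rewrite detZ lerBlDr.
have -> : cabs (U k i) ^+ 2 * cabs (mdet (V k)) = cabs ((U k i)^* ^+ 2 * mdet (V k)).
  by rewrite !cabsM cabsJ expr2.
have -> : \sum_(l | l != k) cabs (U l i) ^+ 2 * cabs (mdet (V l)) =
  \sum_(l | l != k) cabs ((U l i)^* ^+ 2 * mdet (V l)).
  by apply: eq_bigr => l _; rewrite !cabsM cabsJ expr2.
rewrite [X in cabs X + _](bigD1 k) //=; set a := _ * mdet (V k); set b := \sum_(l | _) _.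
apply: le_trans (_ : cabs (a + b) + cabs (- b) <= _).
  by rewrite -{1}[a](addrK b); exact: cabsD.
by rewrite cabsN lerD2l cabs_sum.
Qed.

End Families.

(** * Decompositions with vanishing or proportional determinants *)

Section Equalization.
Variable R : realType.
Local Notation C := R[i].
Local Notation M2 := 'M[C]_2.
Implicit Types (x y z : M2) (s t : seq M2) (h : M2 -> R).

Lemma ge0_ReE (w : C) : 0 <= w -> complex.Re w = cabs w.
Proof.
move=> w0; have := cabsE w; rewrite ger0_norm // => e.
by rewrite [in LHS]e.
Qed.

Lemma pairwise_pol_real s : pairwise (fun x y => mpol x y == 0) s ->
  (forall x, x \in s -> 0 <= mdet x) -> pol_real s.
Proof.
elim: s => // z s IH; rewrite pairwise_cons => /andP[/allP hz /IH{}IH] d0 x y.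
have zz : complex.Im (mpol z z) = 0.
  have := ger0_Im (d0 z (mem_head _ _)).
  by rewrite Im_mpolxx => ->; rewrite mulr0.
rewrite !inE => /predU1P[->|xs] /predU1P[->|ys] //.
- by rewrite (eqP (hz y ys)).
- by rewrite mpolC (eqP (hz x xs)).
- by apply: IH => // w ws; apply: d0; rewrite inE ws orbT.
Qed.

Lemma real_scale (a : R) : (a%:C%C : C) * (a%:C%C)^* = (a ^+ 2)%:C%C.
Proof. by rewrite [_^*](_ : _ = a%:C%C) ?rmorphXn ?expr2 //; exact: conjc_real. Qed.

Lemma imag_scale (a : R) : ('i * a%:C%C : C) * ('i * a%:C%C)^* = (a ^+ 2)%:C%C.
Proof. by rewrite rmorphM /= conjCi mulrACA mulrN -expr2 sqrCi opprK mul1r real_scale. Qed.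

(* Multiplying the second family by 'i flips the sign of its determinants. *)
Lemma balance (X Y : seq M2) (a b : R) : pol_real (X ++ Y) ->
  (forall x y, x \in X -> y \in Y -> mpol x y = 0) ->
  (forall x, x \in X ++ Y -> 0 <= mdet x) -> 0 <= a -> 0 <= b ->
  a * \sum_(x <- X) cabs (mdet x) = b * \sum_(y <- Y) cabs (mdet y) ->
  exists t, (forall i j k l, gram t i j k l = a%:C%C * gram X i j k l + b%:C%C * gram Y i j k l) /\
    forall x, x \in t -> mdet x = 0.
Proof.
move=> pr XY d0 a0 b0 ab.
pose u : C := (Num.sqrt a)%:C%C; pose v : C := 'i * (Num.sqrt b)%:C%C.
pose r := [seq u *: x | x <- X] ++ [seq v *: y | y <- Y].
have u2 : u ^+ 2 = a%:C%C by rewrite -rmorphXn /= sqr_sqrtr.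
have v2 : v ^+ 2 = - b%:C%C by rewrite exprMn sqrCi -rmorphXn /= sqr_sqrtr // mulN1r.
have [|t [tr t0 tp]] := zero_diagonal (@quadratic_mdet R) (s := r).
  rewrite /r big_cat !big_map /=.
  have -> : \sum_(x <- X) complex.Re (mdet (u *: x)) = a * \sum_(x <- X) cabs (mdet x).
    rewrite big_distrr !big_seq; apply: eq_bigr => x xX /=.
    have := d0 x; rewrite mem_cat xX => /(_ isT)/ge0_ReE <-.
    by rewrite mdet_scale u2; case: (mdet x) => ? ? /=; rewrite mul0r subr0.
  have -> : \sum_(y <- Y) complex.Re (mdet (v *: y)) = - (b * \sum_(y <- Y) cabs (mdet y)).
    rewrite big_distrr -sumrN !big_seq; apply: eq_bigr => x xX /=.
    have := d0 x; rewrite mem_cat xX orbT => /(_ isT)/ge0_ReE <-.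
    by rewrite mdet_scale v2; case: (mdet x) => ? ? /=; rewrite oppr0 mul0r subr0 mulNr.
  by rewrite ab subrr.
have {}pr : pol_real r.
  move=> x y; rewrite !mem_cat => /orP[]/mapP[x' x'X ->] /orP[]/mapP[y' y'X ->]; rewrite mpol_scale.
  - have := pr x' y'; rewrite !mem_cat x'X y'X => /(_ isT isT).
    by rewrite -expr2 u2; case: (mpol x' y') => ? ? /= ->; rewrite mulr0 mul0r addr0.
  - by rewrite XY // mulr0.
  - by rewrite mpolC XY // mulr0.
  - have := pr x' y'; rewrite !mem_cat x'X y'X !orbT => /(_ isT isT).
    by rewrite -expr2 v2; case: (mpol x' y') => ? ? /= ->; rewrite mulr0 oppr0 mul0r addr0.
exists t; split=> [i j k l|x xt].
  by rewrite tr gram_cat !gram_scale real_scale imag_scale !sqr_sqrtr.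
by have := tp pr x xt; have := t0 x xt; case: (mdet x) => ? ? /= -> ->.
Qed.

(** The member v is the one at which the partial sums pass half of the total. If v itself carries at
    most half, the three parts satisfy the triangle inequalities. *)
Lemma split_half s (F : M2 -> R) : s != [::] -> (forall x, 0 <= F x) ->
  exists X v Y, [/\ s = X ++ v :: Y, \sum_(x <- X) F x <= (\sum_(x <- s) F x) / 2 &
    \sum_(x <- Y) F x <= (\sum_(x <- s) F x) / 2].
Proof.
move=> s0 F0; set L := (\sum_(x <- s) F x) / 2.
have L0 : 0 <= L by rewrite divr_ge0 // sumr_ge0.
suff H r (c : R) : r != [::] -> 0 <= c -> c <= L -> c + \sum_(x <- r) F x = 2 * L ->
    exists X v Y, [/\ r = X ++ v :: Y, c + \sum_(x <- X) F x <= L & \sum_(x <- Y) F x <= L].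
  have [||||X [v [Y [h1 h2 h3]]]] := H s 0 => //.
    by rewrite add0r /L mulrC divfK // pnatr_eq0.
  by exists X, v, Y; rewrite add0r in h2.
elim: r c => // x r IH c _ c0 cL; rewrite big_cons => e.
have [h|h] := leP (c + F x) L; last first.
  by exists [::], x, r; rewrite big_nil addr0; split=> //; lra.
have [r0|r0] := eqVneq r [::].
  exists [::], x, r; rewrite big_nil addr0; split=> //.
  by rewrite r0 big_nil.
have [||||X [v [Y [h1 h2 h3]]]] := IH (c + F x) => //.
- by rewrite addr_ge0.
- by rewrite -addrA.
by exists (x :: X), v, Y; rewrite h1 big_cons addrA.
Qed.

(* Splitting the family into three parts obeying the triangle inequality lets
   each part be balanced against the two others. *)
Lemma all_separable s : pairwise (fun x y => mpol x y == 0) s ->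
  (forall x, x \in s -> 0 <= mdet x) ->
  (forall x, x \in s -> 2 * cabs (mdet x) <= \sum_(y <- s) cabs (mdet y)) ->
  exists t, same_gram t s /\ forall x, x \in t -> mdet x = 0.
Proof.
move=> pw d0 h; have [->|s0] := eqVneq s [::]; first by exists [::].
have pr := pairwise_pol_real pw d0.
have [X [v [Y [sE hX hY]]]] := split_half s0 (fun x => cabs_ge0 (mdet x)).
have hv : 2 * cabs (mdet v) <= \sum_(y <- s) cabs (mdet y).
  by apply: h; rewrite sE mem_cat mem_head orbT.
move: hX hY hv; rewrite sE big_cat big_cons /=.
pose L (u : seq M2) := \sum_(x <- u) cabs (mdet x).
rewrite -/(L X) -/(L Y); set a := L X; set b := cabs _; set c := L Y => hX hY hv.
have a0 : 0 <= a by apply: sumr_ge0 => *; exact: cabs_ge0.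
have b0 : 0 <= b by exact: cabs_ge0.
have c0 : 0 <= c by apply: sumr_ge0 => *; exact: cabs_ge0.
(* The points of contact of the inscribed circle divide the side x of a triangle into (x + y - z) /
   2 and (x + z - y) / 2; the pieces adjacent to a common vertex are equal, so they can be balanced.
   If x = 0 then y = z and both pieces are 0. *)
have share (x y z : R) : 0 <= x -> 0 <= y -> 0 <= z -> x <= y + z -> y <= x + z -> z <= x + y ->
    exists t : R, [/\ 0 <= t, 0 <= 1 - t, t * x = (x + y - z) / 2 & (1 - t) * x = (x + z - y) / 2].
  move=> x0 y0 z0 xy yx zx; have [xE|nx] := eqVneq x 0.
    by exists 0; rewrite xE; split; lra.
  have xp : 0 < x by rewrite lt_neqAle eq_sym nx.
  exists ((x + y - z) / 2 / x).
  have e : (1 - (x + y - z) / 2 / x) * x = (x + z - y) / 2 by field.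
  split=> //; last by rewrite divfK.
    by apply: divr_ge0 => //; lra.
  by rewrite -(pmulr_lge0 _ xp) e; lra.
have [t1 [t10 t11 e1 e1']] : exists t : R, [/\ 0 <= t, 0 <= 1 - t,
    t * a = (a + b - c) / 2 & (1 - t) * a = (a + c - b) / 2].
  by apply: share; lra.
have [t2 [t20 t21 e2 e2']] : exists t : R, [/\ 0 <= t, 0 <= 1 - t,
    t * b = (b + c - a) / 2 & (1 - t) * b = (b + a - c) / 2].
  by apply: share; lra.
have [t3 [t30 t31 e3 e3']] : exists t : R, [/\ 0 <= t, 0 <= 1 - t,
    t * c = (c + a - b) / 2 & (1 - t) * c = (c + b - a) / 2].
  by apply: share; lra.
have vE : L [:: v] = b by rewrite /L big_seq1.
move: pw; rewrite sE pairwise_cat pairwise_cons allrel_consr => /and3P[/andP[/allP Xv XY] _ /andP[/allP vY _]].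
have mX x : x \in X -> x \in s by rewrite sE mem_cat => ->.
have mY x : x \in Y -> x \in s by rewrite sE mem_cat inE => ->; rewrite !orbT.
have mv x : x \in [:: v] -> x \in s by rewrite sE mem_cat !inE => ->; rewrite !orbT.
have sub (A B : seq M2) : {subset A <= s} -> {subset B <= s} -> {subset A ++ B <= s}.
  by move=> As Bs x; rewrite mem_cat => /orP[/As|/Bs].
have [u1 [g1 z1]] : exists t, (forall i j k l, gram t i j k l =
      t1%:C%C * gram X i j k l + (1 - t2)%:C%C * gram [:: v] i j k l) /\
    forall x, x \in t -> mdet x = 0.
  apply: balance => //.
  - by move=> x y xs ys; apply: pr; apply: sub xs || apply: sub ys.
  - by move=> x y xX; rewrite inE => /eqP->; apply/eqP; exact: Xv.
  - by move=> x /(sub _ _ mX mv); exact: d0.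
  - by rewrite -/(L X) -/(L [:: v]) vE -/a e1 e2'; lra.
have [u2 [g2 z2]] : exists t, (forall i j k l, gram t i j k l =
      t2%:C%C * gram [:: v] i j k l + (1 - t3)%:C%C * gram Y i j k l) /\
    forall x, x \in t -> mdet x = 0.
  apply: balance => //.
  - by move=> x y xs ys; apply: pr; apply: sub xs || apply: sub ys.
  - by move=> x y; rewrite inE => /eqP-> yY; apply/eqP; exact: vY.
  - by move=> x /(sub _ _ mv mY); exact: d0.
  - by rewrite -/(L [:: v]) -/(L Y) vE -/c e2 e3'; lra.
have [u3 [g3 z3]] : exists t, (forall i j k l, gram t i j k l =
      (1 - t1)%:C%C * gram X i j k l + t3%:C%C * gram Y i j k l) /\
    forall x, x \in t -> mdet x = 0.
  apply: balance => //.
  - by move=> x y xs ys; apply: pr; apply: sub xs || apply: sub ys.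
  - by move=> x y xX yY; apply/eqP; exact: (allrelP XY).
  - by move=> x /(sub _ _ mX mY); exact: d0.
  - by rewrite -/(L X) -/(L Y) -/a -/c e3 e1'; lra.
exists (u1 ++ u2 ++ u3); split; last first.
  by move=> x; rewrite !mem_cat => /or3P[/z1|/z2|/z3].
move=> i j k l; have -> : v :: Y = [:: v] ++ Y by [].
by rewrite !gram_cat g1 g2 g3 !rmorphB !rmorph1; ring.
Qed.

(** Multiplying every member but z by 'i turns the sum of the real determinants into the difference
    g. With W the total weight and c = g / W, the form Re det - c weight then has sum 0, so
    [zero_diagonal] annihilates it on each member, and the determinants stay real. *)
Lemma equalize s z : pairwise (fun x y => mpol x y == 0) (z :: s) ->
  (forall x, x \in z :: s -> 0 <= mdet x) ->
  \sum_(x <- s) cabs (mdet x) < cabs (mdet z) ->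
  exists t (c : R), [/\ same_gram t (z :: s), 0 <= c,
    forall x, x \in t -> cabs (mdet x) = c * weight x &
    c * \sum_(x <- z :: s) weight x = cabs (mdet z) - \sum_(x <- s) cabs (mdet x)].
Proof.
move=> pw d0 lt; set g := cabs _ - _; set W := \sum_(x <- _) weight x.
have g0 : 0 < g by rewrite subr_gt0.
have W0 : 0 < W.
  rewrite /W big_cons ltr_wpDr //; first by apply: sumr_ge0 => *; exact: weight_ge0.
  rewrite lt_neqAle weight_ge0 andbT eq_sym; apply/eqP => /weight_eq0 z0.
  have : 0 < cabs (mdet z) by apply: le_lt_trans lt; apply: sumr_ge0 => *; exact: cabs_ge0.
  by rewrite z0 /mdet !mxE !mul0r subrr /cabs /= expr0n addr0 sqrtr0 ltxx.
pose c := g / W.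
have c0 : 0 <= c by rewrite divr_ge0 // ltW.
have cW : c * W = g by rewrite divfK // gt_eqF.
pose r := z :: [seq 'i *: x | x <- s].
have gr : same_gram r (z :: s).
  move=> a b a' b'; rewrite /r -cat1s gram_cat gram_scale.
  by rewrite conjCi mulrN -expr2 sqrCi opprK mul1r -gram_cat.
have wr : \sum_(x <- r) weight x = W by exact: same_gram_weight.
have pr := pairwise_pol_real pw d0.
have q : quadratic (fun x => complex.Re (mdet x) + (- c) * weight x).
  by apply: quadraticD; [exact: quadratic_mdet | apply: quadraticZ; exact: quadratic_weight].
have [|t [tr t0 tp]] := zero_diagonal q (s := r).
  rewrite big_split -big_distrr /= wr mulNr cW /r big_cons big_map.
  have -> : complex.Re (mdet z) = cabs (mdet z) by rewrite ge0_ReE // d0 ?mem_head.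
  have -> : \sum_(x <- s) complex.Re (mdet ('i *: x)) = - \sum_(x <- s) cabs (mdet x).
    rewrite -sumrN !big_seq; apply: eq_bigr => x xs.
    rewrite -ge0_ReE ?d0 ?inE ?xs ?orbT // mdet_scale sqrCi mulN1r.
    by case: (mdet x).
  by rewrite /g; lra.
have {}pr : pol_real r.
  move: pw; rewrite pairwise_cons => /andP[/allP zs _].
  move=> x y; rewrite !inE => /predU1P[->|/mapP[x' x's ->]] /predU1P[->|/mapP[y' y's ->]].
  - by apply: pr; rewrite mem_head.
  - by rewrite mpolC mpol_scalel mpolC (eqP (zs _ y's)) mulr0.
  - by rewrite mpol_scalel mpolC (eqP (zs _ x's)) mulr0.
  - have := pr x' y'; rewrite !inE x's y's !orbT => /(_ isT isT).
    by rewrite mpol_scale -expr2 sqrCi; case: (mpol x' y') => ? ? /= ->; rewrite mulr0 oppr0 mul0r addr0.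
exists t, c; split=> //; first exact: same_gram_trans gr.
move=> x xt; have := tp pr x xt; have := t0 x xt.
rewrite /cabs; case: (mdet x) => u v /= h ->; rewrite expr0n addr0 sqrtr_sqr.
have -> : u = c * weight x by lra.
by rewrite ger0_norm // mulr_ge0 // weight_ge0.
Qed.

End Equalization.

(** * Measuring one qubit of a pure state *)

Section QubitStates.
Variable R : realType.
Local Notation C := R[i].
Local Notation M2 := 'M[C]_2.
Implicit Types (x y z : M2) (s t : seq M2) (h : M2 -> R).

Lemma ord2_cases (i : 'I_2) : i = 0 \/ i = 1.
Proof. by case: i => [[|[|//]] ?]; [left|right]; apply/val_inj. Qed.

Lemma sum_I2 (T : nmodType) (F : 'I_2 -> T) : \sum_i F i = F 0 + F 1.
Proof. by rewrite !big_ord_recl big_ord0 addr0; congr (_ + F _); apply/val_inj. Qed.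

Lemma mdetM x y : mdet (x *m y) = mdet x * mdet y.
Proof. by rewrite /mdet !mxE !sum_I2; ring. Qed.

Lemma mdetJ x : mdet (x ^t*) = (mdet x)^*.
Proof. by rewrite /mdet !mxE rmorphB !rmorphM /=; ring. Qed.

Lemma mdet_addsub x y : mdet (x + y) + mdet (x - y) = 2 * (mdet x + mdet y).
Proof. by rewrite /mdet !mxE; ring. Qed.

Lemma mdetD x y : mdet (x + y) = mdet x + mpol x y + mdet y.
Proof. by rewrite /mdet /mpol !mxE; ring. Qed.

Lemma mpol_mulmx (g f : M2) x y : mpol (g *m x *m f) (g *m y *m f) = mdet g * mdet f * mpol x y.
Proof.
have h (u v : M2) : mpol u v = mdet (u + v) - mdet u - mdet v by rewrite mdetD; ring.
by rewrite !h -mulmxDl -mulmxDr !mdetM; ring.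
Qed.

(** The unnormalised state of the first qubit after an outcome on the second. The contraction with e
    has no conjugation, so the outcome is that of the conjugate vector; conjugation carries
    orthonormal bases to orthonormal bases. *)
Definition post_state s (e : 'cV[C]_2) : M2 := \sum_(x <- s) (x *m e) *m (x *m e) ^t*.
Definition left_state s : M2 := \sum_(x <- s) x *m x ^t*.

Lemma mx2_eq (A B : M2) : A 0 0 = B 0 0 -> A 0 1 = B 0 1 -> A 1 0 = B 1 0 -> A 1 1 = B 1 1 -> A = B.
Proof.
move=> h1 h2 h3 h4; apply/matrixP => i j.
by case: (ord2_cases i) => ->; case: (ord2_cases j) => ->.
Qed.

Lemma trmxC_mul m n p (A : 'M[C]_(m, n)) (B : 'M[C]_(n, p)) : (A *m B) ^t* = B ^t* *m A ^t*.
Proof. by rewrite trmx_mul map_mxM. Qed.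

Lemma post_stateE s e i j : post_state s e i j = \sum_(x <- s) (x *m e) i 0 * ((x *m e) j 0)^*.
Proof. by rewrite summxE; apply: eq_bigr => x _; rewrite mxE big_ord1 !mxE. Qed.

Lemma post_stateD s e f : e *m e ^t* + f *m f ^t* = 1%:M ->
  post_state s e + post_state s f = left_state s.
Proof.
move=> ef; rewrite -big_split; apply: eq_bigr => x _ /=.
by rewrite !trmxC_mul !mulmxA -mulmxDl -!(mulmxA x) -mulmxDr ef mulmx1.
Qed.

Lemma post_stateB s e f :
  post_state s e - post_state s f = \sum_(x <- s) x *m (e *m e ^t* - f *m f ^t*) *m x ^t*.
Proof.
rewrite -sumrB; apply: eq_bigr => x _ /=.
by rewrite !trmxC_mul mulmxBr mulmxBl !mulmxA.
Qed.

Lemma cauchy_schwarz_seq (I : Type) (r : seq I) (u v : I -> C) :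
  let z := \sum_(i <- r) u i * (v i)^* in
  cabs z ^+ 2 <= (\sum_(i <- r) cabs (u i) ^+ 2) * (\sum_(i <- r) cabs (v i) ^+ 2).
Proof.
rewrite /=; elim: r => [|i r IH].
  by rewrite !big_nil /cabs /= expr0n addr0 sqrtr0 expr0n mulr0.
rewrite !big_cons; move: IH.
set z := \sum_(j <- r) _; set p := \sum_(j <- r) _; set q := \sum_(j <- r) _ => IH.
have p0 : 0 <= p by apply: sumr_ge0 => j _; exact: sqr_ge0.
have q0 : 0 <= q by apply: sumr_ge0 => j _; exact: sqr_ge0.
have := cabsD (u i * (v i)^*) z; rewrite cabsM cabsJ.
have := cabs_ge0 (u i); have := cabs_ge0 (v i); have := cabs_ge0 z.
have := cabs_ge0 (u i * (v i)^* + z).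
set a := cabs (u i); set b := cabs (v i); set c := cabs z; set d := cabs _ => d0 c0 b0 a0 dab.
have h : 2 * (a * b) * c <= p * b ^+ 2 + q * a ^+ 2.
  rewrite -ler_sqr ?nnegrE ?mulr_ge0 ?addr_ge0 ?mulr_ge0 ?sqr_ge0 //.
  have -> : (2 * (a * b) * c) ^+ 2 = 4 * (a * b) ^+ 2 * c ^+ 2 by ring.
  apply: le_trans (_ : 4 * (a * b) ^+ 2 * (p * q) <= _); first by rewrite ler_wpM2l // mulr_ge0 // sqr_ge0.
  by rewrite -subr_ge0 (_ : _ - _ = (p * b ^+ 2 - q * a ^+ 2) ^+ 2) ?sqr_ge0 //; ring.
apply: le_trans (_ : (a * b + c) ^+ 2 <= _).
  by rewrite ler_sqr ?nnegrE ?addr_ge0 ?mulr_ge0.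
have -> : (a * b + c) ^+ 2 = a ^+ 2 * b ^+ 2 + 2 * (a * b) * c + c ^+ 2 by ring.
have -> : (a ^+ 2 + p) * (b ^+ 2 + q) = a ^+ 2 * b ^+ 2 + (p * b ^+ 2 + q * a ^+ 2) + p * q by ring.
by rewrite lerD // lerD2l.
Qed.

Record psd2 (x : M2) : Prop := Psd2 {
  psd2_00 : 0 <= x 0 0; psd2_11 : 0 <= x 1 1;
  psd2_10 : x 1 0 = (x 0 1)^*;
  psd2_det : cabs (x 0 1) ^+ 2 <= complex.Re (x 0 0) * complex.Re (x 1 1) }.

Definition rdet x : R := complex.Re (mdet x).

Lemma post_state_psd s e : psd2 (post_state s e).
Proof.
split; rewrite ?post_stateE.
- by apply: sumr_ge0 => x _; rewrite mul_conjC_ge0.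
- by apply: sumr_ge0 => x _; rewrite mul_conjC_ge0.
- by rewrite rmorph_sum; apply: eq_bigr => x _; rewrite rmorphM /= conjCK mulrC.
have h i : complex.Re (\sum_(x <- s) (x *m e) i 0 * ((x *m e) i 0)^*) =
    \sum_(x <- s) cabs ((x *m e) i 0) ^+ 2.
  suff -> : \sum_(x <- s) (x *m e) i 0 * ((x *m e) i 0)^* =
    (\sum_(x <- s) cabs ((x *m e) i 0) ^+ 2)%:C%C by [].
  by rewrite rmorph_sum; apply: eq_bigr => x _; rewrite mulCJ.
rewrite !h; exact: cauchy_schwarz_seq.
Qed.

Lemma psd2_rdetE x : psd2 x ->
  rdet x = complex.Re (x 0 0) * complex.Re (x 1 1) - cabs (x 0 1) ^+ 2.
Proof.
move=> [h0 h1 h2 _]; rewrite /rdet /mdet h2 mulCJ.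
move: (ger0_Im h0) (ger0_Im h1); case: (x 0 0) (x 1 1) => [a b] [c d] /= -> ->.
by ring.
Qed.

Lemma psd2_rdet_ge0 x : psd2 x -> 0 <= rdet x.
Proof. by move=> h; rewrite psd2_rdetE // subr_ge0; exact: psd2_det. Qed.

Lemma sqrtM_sqr (p q : R) : 0 <= p -> 0 <= q ->
  (Num.sqrt p + Num.sqrt q) ^+ 2 = p + q + 2 * Num.sqrt (p * q).
Proof. by move=> p0 q0; rewrite sqrtrM // sqrrD !sqr_sqrtr //; ring. Qed.

(** Minkowski's determinant inequality in dimension 2. Once expanded it bounds 2 sqrt (det x det y)
    by the polar term. With p, q and p', q' the diagonals, this combines p q' + q p' >= 2 sqrt (p q
    p' q') with Cauchy-Schwarz for the vectors (sqrt (det x), |x_01|) and (sqrt (det y), |y_01|),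
    whose squared lengths are p q and p' q'. *)
Lemma psd2_minkowski x y : psd2 x -> psd2 y ->
  (Num.sqrt (rdet x) + Num.sqrt (rdet y)) ^+ 2 <= rdet (x + y).
Proof.
move=> hx hy; have dx := psd2_rdet_ge0 hx; have dy := psd2_rdet_ge0 hy.
rewrite sqrtM_sqr //.
have -> : rdet (x + y) = rdet x + rdet y + complex.Re (mpol x y).
  by rewrite /rdet mdetD; case: (mdet x) (mpol x y) (mdet y) => [? ?] [? ?] [? ?] /=; ring.
rewrite lerD2l.
have [x0 x1 x2 x3] := hx; have [y0 y1 y2 y3] := hy.
move: dx dy x3 y3; rewrite !psd2_rdetE //.
set p := complex.Re (x 0 0); set q := complex.Re (x 1 1).
set p' := complex.Re (y 0 0); set q' := complex.Re (y 1 1).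
have p0 : 0 <= p by rewrite /p ge0_ReE ?cabs_ge0.
have q0 : 0 <= q by rewrite /q ge0_ReE ?cabs_ge0.
have p0' : 0 <= p' by rewrite /p' ge0_ReE ?cabs_ge0.
have q0' : 0 <= q' by rewrite /q' ge0_ReE ?cabs_ge0.
have z0 := cabs_ge0 (x 0 1); have z0' := cabs_ge0 (y 0 1).
have mE : complex.Re (mpol x y) = p * q' + q * p' - 2 * complex.Re (x 0 1 * (y 0 1)^*).
  rewrite /mpol x2 y2 /p /q /p' /q'.
  move: (ger0_Im x0) (ger0_Im x1) (ger0_Im y0) (ger0_Im y1).
  case: (x 0 0) (x 1 1) (x 0 1) (y 0 0) (y 1 1) (y 0 1) => [? ?] [? ?] [? ?] [? ?] [? ?] [? ?] /=.
  by move=> -> -> -> ->; ring.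
have zz : complex.Re (x 0 1 * (y 0 1)^*) <= cabs (x 0 1) * cabs (y 0 1).
  by apply: le_trans (cabs_ge_Re _) _; rewrite cabsM cabsJ.
rewrite mE; set z := cabs (x 0 1) in z0 zz *; set z' := cabs (y 0 1) in z0' zz * => dx dy x3 y3.
apply: le_trans (_ : p * q' + q * p' - 2 * (z * z') <= _); last by rewrite lerB // ler_wpM2l.
rewrite lerBrDr -mulrDr.
have s2 : Num.sqrt ((p * q - z ^+ 2) * (p' * q' - z' ^+ 2)) ^+ 2 =
   (p * q - z ^+ 2) * (p' * q' - z' ^+ 2) by rewrite sqr_sqrtr // mulr_ge0.
set r := Num.sqrt _ in s2 *; have r0 : 0 <= r by exact: sqrtr_ge0.
rewrite -ler_sqr ?nnegrE ?mulr_ge0 ?addr_ge0 ?mulr_ge0 //.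
apply: le_trans (_ : 4 * ((p * q) * (p' * q')) <= _); last first.
  by rewrite -subr_ge0 (_ : _ - _ = (p * q' - q * p') ^+ 2) ?sqr_ge0 //; ring.
have -> : (2 * (r + z * z')) ^+ 2 = 4 * (r ^+ 2 + 2 * r * (z * z') + z ^+ 2 * z' ^+ 2) by ring.
rewrite ler_pM2l // s2.
have h : 2 * r * (z * z') <= (p * q - z ^+ 2) * z' ^+ 2 + (p' * q' - z' ^+ 2) * z ^+ 2.
  rewrite -ler_sqr ?nnegrE ?mulr_ge0 ?addr_ge0 ?mulr_ge0 ?sqr_ge0 //.
  have -> : (2 * r * (z * z')) ^+ 2 = 4 * r ^+ 2 * (z ^+ 2 * z' ^+ 2) by ring.
  rewrite s2 -subr_ge0 (_ : _ - _ = ((p * q - z ^+ 2) * z' ^+ 2 - (p' * q' - z' ^+ 2) * z ^+ 2) ^+ 2) ?sqr_ge0 //.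
  ring.
lra.
Qed.

End QubitStates.

(** * The measurement basis for an entangled pair *)

Section EntangledMeasurement.
Variable R : realType.
Local Notation C := R[i].
Local Notation M2 := 'M[C]_2.
Implicit Types (x y z : M2) (s t : seq M2) (h : M2 -> R).

(** Pythagoras' theorem for the quadratic form [mdet]. *)
Lemma sum_pairwise_mdet (f : M2 -> C) s : pairwise (fun x y => mpol x y == 0) s ->
  mdet (\sum_(x <- s) f x *: x) = \sum_(x <- s) f x ^+ 2 * mdet x.
Proof.
elim: s => [_|x s IH]; first by rewrite !big_nil /mdet !mxE; ring.
rewrite pairwise_cons => /andP[/allP xs /IH{}IH]; rewrite !big_cons mdetD IH mdet_scale.
rewrite mpol_scalel mpol_sumr big_seq big1 ?mulr0 ?addr0 // => y ys.
by rewrite mpolC mpol_scalel mpolC (eqP (xs y ys)) mulr0.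
Qed.

(** For w = 1 this is sigma_x and for w = 'i it is - sigma_y; whenever |w| = 1 its eigenvalues are 1
    and -1. *)
Definition offdiag (w : C) : M2 := \matrix_(i, j)
  if (i == 0) && (j == 1) then w else if (i == 1) && (j == 0) then w^* else 0.

Lemma conj_offdiagE w x i j : (x *m offdiag w *m x ^t*) i j =
  x i 0 * w * (x j 1)^* + x i 1 * w^* * (x j 0)^*.
Proof. by rewrite !mxE !sum_I2 !mxE !sum_I2 !mxE /=; ring. Qed.

Lemma rdetZ (a : R) x y : mdet x = a%:C%C * mdet y -> rdet x = a * rdet y.
Proof. by rewrite /rdet => ->; case: (mdet y) => b c /=; rewrite mul0r subr0. Qed.

(* In the basis where sum x^* x is diagonal, the sum r of the |x_00|^2 is at
   most mu: the orthogonality relations turn det (sum conj(x_00) x) into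
   - r^2 - |beta|^2 on one side and into sum conj(x_00)^2 det x on the other. *)
Lemma traceless_offdiag s (mu : R) :
  pairwise (fun x y => mpol x y == 0) s -> (forall x, x \in s -> x 1 1 = - x 0 0) ->
  (forall x, x \in s -> cabs (mdet x) <= mu) -> 0 <= mu <= 1 ->
  \sum_(x <- s) ((x 0 0)^* * x 0 1 + (x 1 0)^* * x 1 1) = 0 ->
  exists w, w * w^* = 1 /\
    (1 - mu) ^+ 2 <= - rdet (\sum_(x <- 1%:M :: s) x *m offdiag w *m x ^t*).
Proof.
move=> pw tr0 dmu /andP[mu0 mu1] dg.
pose r := \sum_(x <- s) cabs (x 0 0) ^+ 2.
pose b := \sum_(x <- s) (x 0 0)^* * x 0 1.
pose c := \sum_(x <- s) (x 0 0)^* * x 1 0.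
pose q := \sum_(x <- s) x 0 1 * (x 1 0)^*.
have r0 : 0 <= r by apply: sumr_ge0 => x _; exact: sqr_ge0.
have rE : r%:C%C = \sum_(x <- s) x 0 0 * (x 0 0)^*.
  by rewrite rmorph_sum; apply: eq_bigr => x _; rewrite mulCJ.
(* The hypothesis says that the (0, 1) entry of the sum of the x^* x vanishes; substituting x_11 = -
   x_00 relates b to c. *)
have cE : c = b^*.
  have : b - c^* = 0.
    rewrite -dg big_split /=; congr (_ + _).
    rewrite rmorph_sum -sumrN !big_seq; apply: eq_bigr => x xs.
    by rewrite tr0 // rmorphM /= conjCK; ring.
  by move/eqP; rewrite subr_eq0 => /eqP ->; rewrite conjCK.
have r_mu : r <= mu.
  have := sum_pairwise_mdet (fun x => (x 0 0)^*) pw.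
  have -> : mdet (\sum_(x <- s) (x 0 0)^* *: x) = - (r ^+ 2 + cabs b ^+ 2)%:C%C.
    rewrite /mdet !summxE.
    have -> : \sum_(x <- s) ((x 0 0)^* *: x) 0 0 = r%:C%C.
      by rewrite rE; apply: eq_bigr => x _; rewrite mxE mulrC.
    have -> : \sum_(x <- s) ((x 0 0)^* *: x) 1 1 = - r%:C%C.
      rewrite rE -sumrN !big_seq; apply: eq_bigr => x xs.
      by rewrite mxE tr0 // mulrN mulrC.
    have -> : \sum_(x <- s) ((x 0 0)^* *: x) 0 1 = b by apply: eq_bigr => x _; rewrite mxE.
    have -> : \sum_(x <- s) ((x 0 0)^* *: x) 1 0 = c by apply: eq_bigr => x _; rewrite mxE.
    by rewrite cE mulCJ rmorphD !rmorphXn /=; ring.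
  move=> /(congr1 (@cabs R)); rewrite cabsN cabs_real ger0_norm ?addr_ge0 ?sqr_ge0 // => h.
  have : r ^+ 2 + cabs b ^+ 2 <= r * mu.
    rewrite h; apply: le_trans (cabs_sum _ _ _) _.
    rewrite /r big_distrl /= !big_seq; apply: ler_sum => x xs.
    by rewrite cabsM expr2 cabsM cabsJ -expr2 ler_wpM2l ?sqr_ge0 // dmu.
  have [->//|rn] := eqVneq r 0.
  have rp : 0 < r by rewrite lt_neqAle eq_sym rn.
  move=> h'; rewrite -(ler_pM2l rp) -expr2; apply: le_trans h'.
  by rewrite lerDl sqr_ge0.
(* The square of the conjugate of w is 1 for w = 1 and -1 for w = 'i, so one of the two choices
   makes the contribution of q to |T 0 1| favourable. *)
have [w [ww wq]] : exists w : C, w * w^* = 1 /\ 0 <= complex.Re (w^* * w^* * q).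
  have [q0|q0] := leP 0 (complex.Re q).
    by exists 1; rewrite conjC1 !mul1r.
  exists 'i; rewrite conjCi mulrN -expr2 sqrCi opprK mulrNN -expr2 sqrCi mulN1r; split=> //.
  by move: q0; case: (q) => ? ? /= /ltW; rewrite oppr_ge0.
exists w; split=> //.
set T := \sum_(x <- _) _.
have TE i j : T i j = ((1%:M : M2) i 0 * w * ((1%:M : M2) j 1)^* + (1%:M : M2) i 1 * w^* * ((1%:M : M2) j 0)^*) +
    (w * (\sum_(x <- s) x i 0 * (x j 1)^*) + w^* * (\sum_(x <- s) x i 1 * (x j 0)^*)).
  rewrite /T summxE big_cons conj_offdiagE; congr (_ + _).
  rewrite !big_distrr -big_split /=; apply: eq_bigr => x _.
  by rewrite conj_offdiagE; ring.
have bE : \sum_(x <- s) x 0 1 * (x 0 0)^* = b by apply: eq_bigr => x _; rewrite mulrC.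
have bJ : \sum_(x <- s) x 0 0 * (x 0 1)^* = b^*.
  by rewrite rmorph_sum; apply: eq_bigr => x _; rewrite rmorphM /= conjCK.
have T00 : T 0 0 = w * b^* + w^* * b.
  by rewrite TE bE bJ !mxE /= conjC0 conjC1; ring.
have T11 : T 1 1 = - T 0 0.
  have -> : T 1 1 = - (w * c + w^* * c^*).
    rewrite TE !mxE /= conjC0 conjC1 !mulr0 !mul0r !add0r opprD; congr (_ + _).
      rewrite -mulrN -sumrN !big_seq; congr (_ * _); apply: eq_bigr => x xs.
      by rewrite tr0 // rmorphN /=; ring.
    rewrite -mulrN rmorph_sum -sumrN !big_seq; congr (_ * _); apply: eq_bigr => x xs.
    by rewrite tr0 // rmorphM /= conjCK; ring.
  by rewrite T00 cE conjCK.
have T01 : T 0 1 = w * (1 - r%:C%C) + w^* * q.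
  rewrite TE !mxE /= conjC0 conjC1 -/q.
  have -> : \sum_(x <- s) x 0 0 * (x 1 1)^* = - r%:C%C.
    rewrite rE -sumrN !big_seq; apply: eq_bigr => x xs.
    by rewrite tr0 // rmorphN mulrN.
  by ring.
have rJ : (r%:C%C)^* = r%:C%C :> C by exact: conjc_real.
have T10 : T 1 0 = (T 0 1)^*.
  rewrite T01 rmorphD !rmorphM rmorphB rmorph1 /= rJ conjCK TE !mxE /= conjC0 conjC1.
  have -> : \sum_(x <- s) x 1 1 * (x 0 0)^* = - r%:C%C.
    rewrite rE -sumrN !big_seq; apply: eq_bigr => x xs.
    by rewrite tr0 // mulNr.
  have -> : \sum_(x <- s) x 1 0 * (x 0 1)^* = q^*.
    by rewrite rmorph_sum; apply: eq_bigr => x _; rewrite rmorphM /= conjCK mulrC.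
  by ring.
have T00J : T 0 0 = (T 0 0)^*.
  by rewrite T00 rmorphD !rmorphM /= !conjCK; ring.
(* T is Hermitian and traceless, so - det T is a sum of two squares; the off-diagonal one is already
   at least (1 - r)^2. *)
have -> : rdet T = - (cabs (T 0 0) ^+ 2 + cabs (T 0 1) ^+ 2).
  rewrite /rdet /mdet T11 T10 mulCJ mulrN {2}T00J mulCJ.
  by rewrite -rmorphN -rmorphB /=; ring.
rewrite opprK; apply: le_trans (_ : cabs (T 0 1) ^+ 2 <= _); last by rewrite lerDr sqr_ge0.
rewrite ler_sqr ?nnegrE ?cabs_ge0 ?subr_ge0 //.
apply: le_trans (_ : 1 - r <= _); first by rewrite lerB.
have cw : cabs w = 1.
  apply/eqP; rewrite -(@pexpr_eq1 _ _ 2) ?cabs_ge0 //; apply/eqP/(@complexI R).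
  by rewrite -mulCJ ww.
have -> : cabs (T 0 1) = cabs (w^* * T 0 1) by rewrite cabsM cabsJ cw mul1r.
apply: le_trans (cabs_ge_Re _).
have -> : w^* * T 0 1 = (1 - r%:C%C) + w^* * w^* * q.
  by rewrite T01 mulrDr !mulrA [w^* * w]mulrC ww mul1r.
by move: wq; case: (_ * q) => u v /=; lra.
Qed.

Lemma rdet_addsub x y : rdet (x + y) + rdet (x - y) = 2 * (rdet x + rdet y).
Proof.
have ReD (v w : C) : complex.Re v + complex.Re w = complex.Re (v + w).
  by case: v w => ? ? [? ?].
rewrite /rdet !ReD mdet_addsub.
by case: (mdet x + mdet y) => ? ? /=; ring.
Qed.

Lemma trmxC_sum (I : Type) (r : seq I) (F : I -> M2) :
  (\sum_(i <- r) F i) ^t* = \sum_(i <- r) (F i) ^t*.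
Proof.
apply/matrixP => i j; rewrite !mxE summxE rmorph_sum summxE.
by apply: eq_bigr => k _; rewrite !mxE.
Qed.

Lemma post_state_mulmx (g h : M2) (e : 'cV[C]_2) s : h *m h ^t* = 1%:M ->
  post_state [seq g *m x *m h | x <- s] (h ^t* *m e) = g *m post_state s e *m g ^t*.
Proof.
move=> hh; rewrite /post_state big_map mulmx_sumr mulmx_suml; apply: eq_bigr => x _.
have -> : g *m x *m h *m (h ^t* *m e) = g *m (x *m e).
  by rewrite !mulmxA -(mulmxA (g *m x)) hh mulmx1.
by rewrite !trmxC_mul !mulmxA.
Qed.

Lemma left_state_mulmx (g h : M2) s : h *m h ^t* = 1%:M ->
  left_state [seq g *m x *m h | x <- s] = g *m left_state s *m g ^t*.
Proof.
move=> hh; rewrite /left_state big_map mulmx_sumr mulmx_suml; apply: eq_bigr => x _.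
by rewrite !trmxC_mul !mulmxA -(mulmxA (g *m x)) hh mulmx1.
Qed.

Lemma rdet_conj (g : M2) x : rdet (g *m x *m g ^t*) = cabs (mdet g) ^+ 2 * rdet x.
Proof. by apply: rdetZ; rewrite !mdetM mdetJ mulrAC mulCJ. Qed.

(** With P and Q the two post-measurement states, (sqrt (det P) + sqrt (det Q))^2 <= 2 (det P + det
    Q) = det (P + Q) + det (P - Q), where P + Q is the marginal and P - Q is the operator bounded in
    the hypothesis. The factor l^2 undoes the normalisation of the leading member to the
    identity. *)
Lemma scaled_measurement Y (e f : 'cV[C]_2) (l mu : R) w : 0 < l ->
  e *m e ^t* + f *m f ^t* = 1%:M -> e *m e ^t* - f *m f ^t* = offdiag w ->
  (1 - mu / l) ^+ 2 <= - rdet (\sum_(x <- Y) x *m offdiag w *m x ^t*) ->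
  (Num.sqrt (l ^+ 2 * rdet (post_state Y e)) + Num.sqrt (l ^+ 2 * rdet (post_state Y f))) ^+ 2 +
    (l - mu) ^+ 2 <= l ^+ 2 * rdet (left_state Y).
Proof.
move=> l0 efD efB wP.
have pA := psd2_rdet_ge0 (post_state_psd Y e).
have pB := psd2_rdet_ge0 (post_state_psd Y f).
rewrite !(@sqrtrM _ (l ^+ 2) _ (sqr_ge0 l)) sqrtr_sqr ger0_norm ?(ltW l0) // -mulrDr exprMn.
have -> : (l - mu) ^+ 2 = l ^+ 2 * (1 - mu / l) ^+ 2 by field; rewrite gt_eqF.
rewrite -mulrDr ler_wpM2l ?sqr_ge0 //.
have := rdet_addsub (post_state Y e) (post_state Y f).
rewrite (post_stateD Y efD) post_stateB efB.
have := sqr_sqrtr pA; have := sqr_sqrtr pB; move: wP.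
set a := Num.sqrt _; set b := Num.sqrt _ => wP <- <- h.
have := sqr_ge0 (a - b); rewrite sqrrB sqrrD; lra.
Qed.

(** The family is written as x = g (h x) S, where z corresponds to the identity and S is unitary.
    Such a substitution multiplies [mdet] and [mpol] by [mdet z], so orthogonality survives and mu
    becomes mu / |det z|; on the measured qubit it is a mere change of basis. *)
Lemma entangled_measurement z s (mu : R) : pairwise (fun x y => mpol x y == 0) (z :: s) ->
  0 < cabs (mdet z) -> 0 <= mu <= cabs (mdet z) -> (forall x, x \in s -> cabs (mdet x) <= mu) ->
  exists e f : 'cV[C]_2, e *m e ^t* + f *m f ^t* = 1%:M /\
    (Num.sqrt (rdet (post_state (z :: s) e)) + Num.sqrt (rdet (post_state (z :: s) f))) ^+ 2 +
    (cabs (mdet z) - mu) ^+ 2 <= rdet (left_state (z :: s)).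
Proof.
rewrite pairwise_cons => /andP[/allP zs pw] l0 /andP[mu0 mul] smu.
have zu : z \in unitmx.
  rewrite unitmxE unitfE; apply: contraTneq l0 => dz.
  suff -> : mdet z = 0 by rewrite /cabs /= expr0n addr0 sqrtr0 ltxx.
  by rewrite -dz /mdet; apply/esym; rewrite (expand_det_row _ 0) sum_I2 /cofactor !det_mx11 !mxE /=;
    rewrite addn0 expr0 expr1 mulN1r mul1r mulrN; congr (_ * z _ _ - _ * z _ _); apply/val_inj.
pose P := \sum_(x <- s) (invmx z *m x) ^t* *m (invmx z *m x).
pose S := spectralmx P.
have Su : S *m S ^t* = 1%:M by apply/unitarymxP/spectral_unitarymx.
have Su' : S ^t* *m S = 1%:M by apply: mulmx1C.
have Pd : S *m P *m S ^t* = diag_mx (spectral_diag P).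
  have PJ : P ^t* = P.
    by rewrite {1}/P trmxC_sum; apply: eq_bigr => x _; rewrite [LHS]trmxC_mul trmxCK.
  have /orthomx_spectralP PE : P \is normalmx.
    by apply: hermitian_normalmx; apply/is_hermitianmxP; rewrite expr0 scale1r PJ.
  rewrite [X in S *m X]PE -/S invmx_unitary ?spectral_unitarymx // !mulmxA Su mul1mx.
  by rewrite -mulmxA Su mulmx1.
pose g := z *m S ^t*; pose h x := S *m invmx z *m x *m S ^t*.
have gh x : g *m h x *m S = x.
  rewrite /g /h !mulmxA -(mulmxA z) Su' mulmx1 mulmxV // mul1mx.
  by rewrite -mulmxA Su' mulmx1.
have g1 : g *m 1%:M *m S = z by rewrite /g mulmx1 -mulmxA Su' mulmx1.
have sE : z :: s = [seq g *m x *m S | x <- 1%:M :: map h s].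
  rewrite /= g1; congr (_ :: _); rewrite -map_comp -[LHS]map_id.
  by apply: eq_map => x /=; rewrite gh.
have gS : mdet g * mdet S = mdet z.
  by rewrite -mdetM -[g]mulmx1 g1.
have dz0 : mdet z != 0 by rewrite -cabs_eq0 gt_eqF.
have mh x y : mpol x y = mdet z * mpol (h x) (h y).
  by rewrite -gS -mpol_mulmx !gh.
have dh x : mdet x = mdet z * mdet (h x).
  by rewrite -gS mulrAC -!mdetM gh.
have cS : cabs (mdet S) = 1.
  apply/eqP; rewrite -(@pexpr_eq1 _ _ 2) ?cabs_ge0 //; apply/eqP/(@complexI R).
  by rewrite -mulCJ -mdetJ -mdetM Su /mdet !mxE /= !mulr1 mulr0 subr0.
have cg : cabs (mdet g) = cabs (mdet z) by rewrite -gS cabsM cS mulr1.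
have [|||||w [ww wP]] := @traceless_offdiag (map h s) (mu / cabs (mdet z)).
- rewrite pairwise_map; apply: sub_pairwise pw => x y /= /eqP xy.
  by rewrite -(inj_eq (mulfI dz0)) -mh xy mulr0.
(* The polar form of the identity with y is the trace of y. *)
- move=> _ /mapP[x xs ->]; have := zs x xs.
  rewrite -[X in mpol X _]g1 -[X in mpol _ X]gh mpol_mulmx mulf_eq0 gS (negbTE dz0) /= => /eqP.
  rewrite /mpol !mxE /= !mul1r !mul0r !subr0 => /eqP; rewrite addrC addr_eq0 => /eqP ->.
  by rewrite opprK.
- move=> _ /mapP[x xs ->]; rewrite ler_pdivlMr // mulrC -cabsM -dh; exact: smu.
- by rewrite divr_ge0 ?cabs_ge0 // ler_pdivrMr // mul1r.
- have /matrixP/(_ 0 1) := Pd; rewrite [RHS]mxE /= mulr0n => hP; apply: etrans hP.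
  rewrite /P mulmx_sumr mulmx_suml summxE big_map; apply: eq_bigr => x _.
  have -> : S *m ((invmx z *m x)^t* *m (invmx z *m x)) *m S ^t* = (h x) ^t* *m h x.
    rewrite /h !trmxC_mul trmxCK !mulmxA -[_ *m S ^t* *m S]mulmxA Su' mulmx1 //.
  by move: (h x) => y; rewrite mxE sum_I2 !mxE.
pose k : C := (Num.sqrt 2^-1)%:C%C.
have kk : k * k = 2^-1.
  rewrite /k -rmorphM /= -expr2 sqr_sqrtr ?invr_ge0 //.
  by rewrite fmorphV /= rmorph_nat.
have kJ : k^* = k by exact: conjc_real.
(* For |w| = 1, [e0 w] and [e0 (- w)] are the unit eigenvectors of [offdiag w] for the eigenvalues 1
   and -1. *)
pose e0 (w' : C) : 'cV[C]_2 := \col_i if i == 0 then k else k * w'^*.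
have e0E w' i j : (e0 w' *m (e0 w') ^t*) i j = (e0 w' i 0) * (e0 w' j 0)^*.
  by rewrite mxE big_ord1 !mxE.
have half : 2^-1 + 2^-1 = 1 :> C by field.
have e0D : e0 w *m (e0 w) ^t* + e0 (- w) *m (e0 (- w)) ^t* = 1%:M.
  apply: mx2_eq; rewrite [LHS]mxE !e0E !mxE /= ?rmorphM ?rmorphN /= ?conjCK ?kJ.
  - by rewrite kk.
  - by ring.
  - by ring.
  - have -> : k * w^* * (k * w) + k * - w^* * (k * - w) = (k * k + k * k) * (w * w^*) by ring.
    by rewrite ww kk half mulr1.
have e0B : e0 w *m (e0 w) ^t* - e0 (- w) *m (e0 (- w)) ^t* = offdiag w.
  apply: mx2_eq; rewrite [LHS]mxE [in X in _ + X]mxE !e0E !mxE /= ?rmorphM ?rmorphN /= ?conjCK ?kJ.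
  - by ring.
  - by have -> : k * (k * w) - k * (k * - w) = (k * k + k * k) * w by [ring]; rewrite kk half mul1r.
  - by have -> : k * w^* * k - k * - w^* * k = (k * k + k * k) * w^* by [ring]; rewrite kk half mul1r.
  - by ring.
move: (1%:M :: map h s) sE wP => Y sE wP.
have rpE e : rdet (post_state (z :: s) (S ^t* *m e)) = cabs (mdet z) ^+ 2 * rdet (post_state Y e).
  by rewrite sE post_state_mulmx // -cg rdet_conj.
have rlE : rdet (left_state (z :: s)) = cabs (mdet z) ^+ 2 * rdet (left_state Y).
  by rewrite sE left_state_mulmx // -cg rdet_conj.
have [e [f [ef re rf]]] : exists e f : 'cV[C]_2, [/\ e *m e ^t* + f *m f ^t* = 1%:M,
    rdet (post_state (z :: s) e) = cabs (mdet z) ^+ 2 * rdet (post_state Y (e0 w)) &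
    rdet (post_state (z :: s) f) = cabs (mdet z) ^+ 2 * rdet (post_state Y (e0 (- w)))].
  exists (S ^t* *m e0 w), (S ^t* *m e0 (- w)); split; [|exact: rpE|exact: rpE].
  by rewrite !trmxC_mul trmxCK !mulmxA -mulmxDl -!(mulmxA (S ^t*)) -mulmxDr e0D mulmx1.
exists e, f; split=> //; rewrite re rf rlE.
exact: (scaled_measurement _ e0D e0B).
Qed.

End EntangledMeasurement.

(** * Separable and entangled pairs brought together *)

Section Measurement.
Variable R : realType.
Local Notation C := R[i].
Local Notation M2 := 'M[C]_2.
Implicit Types (x y z : M2) (s t : seq M2) (h : M2 -> R).

Lemma pairwise_perm (T : eqType) (r : rel T) (s t : seq T) : symmetric r ->
  perm_eq s t -> pairwise r s = pairwise r t.
Proof.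
move=> rs; suff H (u v : seq T) : perm_eq u v -> pairwise r u -> pairwise r v.
  by move=> st; apply/idP/idP; apply: H; rewrite // perm_sym.
elim: u v => [|x u IH] v; first by rewrite perm_sym => /perm_nilP->.
move=> p; have xv : x \in v by rewrite -(perm_mem p) mem_head.
case/splitPr: xv p => v1 v2 p.
have {}p : perm_eq u (v1 ++ v2).
  by rewrite -(perm_cons x) (perm_trans p) // perm_sym -cat1s perm_catCA.
rewrite pairwise_cons => /andP[/allP xu /(IH _ p)].
rewrite !pairwise_cat pairwise_cons allrel_consr => /and3P[-> -> ->]; rewrite !andbT.
apply/andP; split; apply/allP => y yv; last by apply: xu; rewrite (perm_mem p) mem_cat yv orbT.
by rewrite rs; apply: xu; rewrite (perm_mem p) mem_cat yv.
Qed.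

Lemma same_gram_sum s t i j (e f : 'I_2 -> C) : same_gram s t ->
  \sum_(x <- s) (\sum_b x i b * e b) * (\sum_b x j b * f b)^* =
  \sum_(x <- t) (\sum_b x i b * e b) * (\sum_b x j b * f b)^*.
Proof.
move=> st.
have H (u : seq M2) : \sum_(x <- u) (\sum_b x i b * e b) * (\sum_b x j b * f b)^* =
    \sum_b \sum_b' e b * (f b')^* * gram u i b j b'.
  rewrite /gram; under [RHS]eq_bigr do under eq_bigr do rewrite big_distrr /=.
  under [RHS]eq_bigr do rewrite exchange_big /=.
  rewrite exchange_big /=; apply: eq_bigr => x _.
  rewrite rmorph_sum big_distrl; apply: eq_bigr => b _ /=.
  by rewrite big_distrr; apply: eq_bigr => b' _ /=; rewrite rmorphM /=; ring.
by rewrite !H; apply: eq_bigr => b _; apply: eq_bigr => b' _; rewrite st.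
Qed.

Lemma same_gram_post s t e : same_gram s t -> post_state s e = post_state t e.
Proof.
move=> st; apply/matrixP => i j; rewrite !post_stateE.
have := same_gram_sum i j (fun b => e b 0) (fun b => e b 0) st.
by congr (_ = _); apply: eq_bigr => x _; rewrite !mxE.
Qed.

Definition basis_ket (k : 'I_2) : 'cV[C]_2 := \col_i (i == k)%:R.

Lemma basis_ketD : basis_ket 0 *m basis_ket 0 ^t* + basis_ket 1 *m basis_ket 1 ^t* = 1%:M.
Proof.
by apply: mx2_eq; rewrite !mxE !big_ord1 !mxE /= ?conjC0 ?conjC1 ?mulr1 ?mulr0 ?addr0 ?add0r.
Qed.

Lemma left_state_post s : left_state s = post_state s (basis_ket 0) + post_state s (basis_ket 1).
Proof. by rewrite (post_stateD _ basis_ketD). Qed.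

Lemma same_gram_left s t : same_gram s t -> left_state s = left_state t.
Proof. by move=> st; rewrite !left_state_post !(same_gram_post _ st). Qed.

Lemma takagi_cases s : exists V, same_gram V s /\
  ((exists t, same_gram t s /\ forall x, x \in t -> mdet x = 0) \/
   (exists z r, [/\ V = z :: r, pairwise (fun x y => mpol x y == 0) (z :: r),
      forall x, x \in z :: r -> 0 <= mdet x,
      \sum_(x <- r) cabs (mdet x) < cabs (mdet z) &
      cabs (mdet z) - \sum_(x <- r) cabs (mdet x) <= \sum_(x <- s) cabs (mdet x)])).
Proof.
have [V [Vs pw d0 le]] := takagi_family s.
have [|/allPn[z zV]] := boolP (all (fun x => 2 * cabs (mdet x) <= \sum_(y <- V) cabs (mdet y)) V).
  move=> /allP h; have [t [tV t0]] := all_separable pw d0 h.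
  by exists V; split=> //; left; exists t; split=> //; exact: same_gram_trans Vs.
have pV := perm_to_rem zV.
rewrite -ltNge => h; exists (z :: rem z V); split.
  by apply: same_gram_trans Vs; apply: perm_gram; rewrite perm_sym.
right; exists z, (rem z V); have := le z zV; move: h.
rewrite !(perm_big _ pV) /= !big_cons => h hle; split=> //.
- have sm : symmetric (fun x y : M2 => mpol x y == 0) by move=> x y; rewrite mpolC.
  by move: pw; rewrite (pairwise_perm sm pV).
- by move=> x; rewrite -(perm_mem pV); exact: d0.
- by lra.
- by apply: le_trans hle; lra.
Qed.

(** In the separable case c = 0 and Minkowski's determinant inequality allows any orthonormal basis.
    In the entangled case mu is taken to be the sum of the other determinants: it bounds each of
    them, and |det z| - mu is then exactly the total |det| of the equalised decomposition. *)
Lemma measurement s : exists (e f : 'cV[C]_2) t (c : R),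
  [/\ e *m e ^t* + f *m f ^t* = 1%:M, same_gram t s, 0 <= c,
      \sum_(x <- t) cabs (mdet x) <= c &
      (Num.sqrt (rdet (post_state s e)) + Num.sqrt (rdet (post_state s f))) ^+ 2 + c ^+ 2 <=
        rdet (left_state s)].
Proof.
have [V [Vs [[t [ts t0]]|[z [r [VE pw d0 lt _]]]]]] := takagi_cases s.
  exists (basis_ket 0), (basis_ket 1), t, 0; split=> //; first exact: basis_ketD.
    rewrite big_seq big1 // => x /t0 ->; by rewrite /cabs /= expr0n addr0 sqrtr0.
  rewrite expr0n addr0 left_state_post; apply: psd2_minkowski; exact: post_state_psd.
move: Vs; rewrite VE => Vs.
have [t [c [tV c0 tc cW]]] := equalize pw d0 lt.
have s0 : 0 <= \sum_(x <- r) cabs (mdet x) by apply: sumr_ge0 => *; exact: cabs_ge0.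
have [|||e [f [ef h]]] := @entangled_measurement _ z r (\sum_(x <- r) cabs (mdet x)) pw.
- exact: le_lt_trans lt.
- by rewrite s0 ltW.
- move=> x xr; rewrite (big_rem x) //= lerDl; apply: sumr_ge0 => *; exact: cabs_ge0.
exists e, f, t, (cabs (mdet z) - \sum_(x <- r) cabs (mdet x)); split=> //.
- exact: same_gram_trans Vs.
- by rewrite subr_ge0 ltW.
- rewrite -cW -(same_gram_weight tV) big_distrr /= !big_seq.
  by apply: ler_sum => x xt; rewrite tc.
- by rewrite -!(same_gram_post _ Vs) -(same_gram_left Vs).
Qed.

(** Turns a bound on the total into a bound on each member. As the total weight is 1, the ratio in
    the equalised decomposition is the difference of Takagi determinants, and the last clause of
    [takagi_family] bounds it by the total |det| of s itself. *)
Lemma equal_concurrence s (c : R) : \sum_(x <- s) weight x = 1 ->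
  \sum_(x <- s) cabs (mdet x) <= c ->
  exists t, same_gram t s /\ forall x, x \in t -> cabs (mdet x) <= c * weight x.
Proof.
move=> s1 sc.
have c0 : 0 <= c by apply: le_trans sc; apply: sumr_ge0 => *; exact: cabs_ge0.
have [V [Vs [[t [ts t0]]|[z [r [VE pw d0 lt le]]]]]] := takagi_cases s.
  exists t; split=> // x /t0 ->.
  by rewrite {1}/cabs /= expr0n addr0 sqrtr0 mulr_ge0 // weight_ge0.
move: Vs; rewrite VE => Vs.
have [t [c' [tV c0' tc cW]]] := equalize pw d0 lt.
exists t; split; first exact: same_gram_trans Vs.
move=> x /tc ->; rewrite ler_wpM2r ?weight_ge0 //.
move: cW; rewrite (same_gram_weight Vs) s1 mulr1 => ->.
exact: le_trans sc.
Qed.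

End Measurement.

(** * Monogamy for pure states of n qubits *)

Section Configurations.
Variable R : realType.
Local Notation C := R[i].
Local Notation M2 := 'M[C]_2.
Implicit Types (x y z : M2) (s t : seq M2) (h : M2 -> R).

(** Minkowski's inequality for the Euclidean norm, squared, with upper bounds A and B in place of
    the squared norms. *)
Lemma sum_sqrD (I : eqType) (r : seq I) (a b : I -> R) (A B : R) :
  (forall i, i \in r -> 0 <= a i) -> (forall i, i \in r -> 0 <= b i) ->
  \sum_(i <- r) a i ^+ 2 <= A -> \sum_(i <- r) b i ^+ 2 <= B ->
  \sum_(i <- r) (a i + b i) ^+ 2 <= (Num.sqrt A + Num.sqrt B) ^+ 2.
Proof.
move=> a0 b0 hA hB.
have A0 : 0 <= A by apply: le_trans hA; apply: sumr_ge0 => *; exact: sqr_ge0.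
have B0 : 0 <= B by apply: le_trans hB; apply: sumr_ge0 => *; exact: sqr_ge0.
have cs : (\sum_(i <- r) a i * b i) ^+ 2 <= (\sum_(i <- r) a i ^+ 2) * (\sum_(i <- r) b i ^+ 2).
  have nE (x : R) : cabs x%:C%C ^+ 2 = x ^+ 2 by rewrite cabs_real real_normK ?num_real.
  have := cauchy_schwarz_seq r (fun i => (a i)%:C%C) (fun i => (b i)%:C%C).  cbv zeta.
  have -> : \sum_(i <- r) (a i)%:C%C * ((b i)%:C%C)^* = (\sum_(i <- r) a i * b i)%:C%C :> C.
    rewrite rmorph_sum; apply: eq_bigr => i _; rewrite rmorphM /=; congr (_ * _).
    exact: conjc_real.
  rewrite nE; under [X in _ <= X * _]eq_bigr do rewrite nE.
  by under [X in _ <= _ * X]eq_bigr do rewrite nE.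
have S0 : 0 <= \sum_(i <- r) a i * b i.
  by rewrite big_seq; apply: sumr_ge0 => i ir; rewrite mulr_ge0 ?a0 ?b0.
have h : \sum_(i <- r) a i * b i <= Num.sqrt (A * B).
  rewrite -(ger0_norm S0) -sqrtr_sqr ler_wsqrtr //; apply: le_trans cs _.
  by apply: ler_pM => //; apply: sumr_ge0 => *; exact: sqr_ge0.
rewrite sqrtM_sqr //.
have -> : \sum_(i <- r) (a i + b i) ^+ 2 = \sum_(i <- r) a i ^+ 2 + \sum_(i <- r) b i ^+ 2 +
    2 * \sum_(i <- r) a i * b i.
  by rewrite big_distrr -!big_split /=; apply: eq_bigr => i _; ring.
lra.
Qed.

Section Qubits.
Variable n : nat.
Implicit Types (psi : config n -> C) (f : config n) (i j k l : 'I_n) (a b : 'I_2).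

Definition upd f k a : config n := [ffun i => if i == k then a else f i].

Lemma updC f j k a b : j != k -> upd (upd f j b) k a = upd (upd f k a) j b.
Proof.
move=> jk; apply/ffunP => i; rewrite !ffunE.
by have [->|//] := eqVneq i k; rewrite eq_sym (negbTE jk).
Qed.

(** Exchanging the bit f j with b is an involution on the pairs (f, b), under which [upd f j b]
    becomes f. *)
Lemma sum_upd (F : config n -> C) j : \sum_f \sum_b F (upd f j b) = 2 * \sum_f F f.
Proof.
rewrite pair_bigA /=.
pose s (p : config n * 'I_2) := (upd p.1 j p.2, p.1 j).
have ss : involutive s.
  move=> [f b]; rewrite /s /= ffunE eqxx; congr (_, _).
  by apply/ffunP => i; rewrite !ffunE; have [->|] := eqVneq i j.
rewrite (reindex_inj (inv_inj ss)) /=.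
under eq_bigr => p _.
  have -> : upd (upd p.1 j p.2) j (p.1 j) = p.1.
    by apply/ffunP => i; rewrite !ffunE; have [->|] := eqVneq i j.
  over.
rewrite -(pair_bigA _ (fun f (_ : 'I_2) => F f)) /= big_distrr; apply: eq_bigr => f _.
by rewrite sum_I2 /=; ring.
Qed.

Definition slice psi k j f : M2 := \matrix_(a, b) (2^-1 * psi (upd (upd f k a) j b)).

(* Each slice is repeated four times in the sum over all configurations f,
   which the factor 1/2 in the amplitudes compensates. *)
Definition pair_family psi k j : seq M2 := [seq slice psi k j f | f <- enum (config n)].

(** The factor 1/2 is there because the bit f k is overwritten, so each term occurs twice. *)
Definition marginal psi k : M2 :=
  \matrix_(a, a') (2^-1 * \sum_f psi (upd f k a) * (psi (upd f k a'))^*).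

(** The measured qubit is kept as a dummy: the amplitude does not depend on f j, and the factor sqrt
    (1/2) corrects the norm for the repetition. All states thus stay on the same n qubits during the
    induction. *)
Definition measured psi j (e : 'cV[C]_2) : config n -> C :=
  fun f => (Num.sqrt 2^-1)%:C%C * \sum_b e b 0 * psi (upd f j b).

Lemma half_conj : (2^-1 : C)^* = 2^-1.
Proof. by rewrite fmorphV /= conjC_nat. Qed.

Lemma sqrt_half : (Num.sqrt 2^-1)%:C%C * ((Num.sqrt 2^-1)%:C%C)^* = 2^-1 :> C.
Proof. by rewrite mulCJ cabs_real ger0_norm ?sqrtr_ge0 // sqr_sqrtr ?invr_ge0 // fmorphV /= rmorph_nat. Qed.

Lemma gram_pair_family psi k j a b a' b' : gram (pair_family psi k j) a b a' b' =
  4^-1 * \sum_f psi (upd (upd f k a) j b) * (psi (upd (upd f k a') j b'))^*.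
Proof.
rewrite /gram big_map big_enum big_distrr /=; apply: eq_bigr => f _.
rewrite !mxE rmorphM /= half_conj.
by field.
Qed.

Lemma left_state_family psi k j : j != k -> left_state (pair_family psi k j) = marginal psi k.
Proof.
move=> jk; apply/matrixP => a a'; rewrite /left_state summxE big_map big_enum /= mxE.
pose G f := psi (upd f k a) * (psi (upd f k a'))^*.
have := sum_upd G j; rewrite -/(G _) => hG.
transitivity (4^-1 * \sum_f \sum_b G (upd f j b)); last by rewrite hG; field.
rewrite big_distrr; apply: eq_bigr => f _; rewrite mxE big_distrr; apply: eq_bigr => b _ /=.
by rewrite !mxE rmorphM /= half_conj /G !(updC _ _ _ jk); field.
Qed.

Lemma post_state_family psi k j e : j != k ->
  post_state (pair_family psi k j) e = marginal (measured psi j e) k.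
Proof.
move=> jk; apply/matrixP => a a'; rewrite post_stateE big_map big_enum /= mxE big_distrr.
apply: eq_bigr => f _; rewrite /measured !mxE /=.
have H c : \sum_b slice psi k j f c b * e b 0 = 2^-1 * \sum_b e b 0 * psi (upd (upd f k c) j b).
  by rewrite big_distrr; apply: eq_bigr => b _; rewrite mxE /=; ring.
rewrite !H !rmorphM /= half_conj.
set x := \sum_b _; set y := (\sum_b _)^*.
transitivity (2^-1 * (2^-1 : C) * (x * y)); first by ring.
by rewrite -{2}sqrt_half; ring.
Qed.

(** No signalling: a measurement of qubit j, summed over its outcomes, leaves the state of the other
    two qubits alone. Decompositions for the two outcomes therefore concatenate to one for psi. *)
Lemma gram_measured psi k j l (e f : 'cV[C]_2) a b a' b' : j != k -> l != j ->
  e *m e ^t* + f *m f ^t* = 1%:M ->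
  gram (pair_family (measured psi j e) k l) a b a' b' +
  gram (pair_family (measured psi j f) k l) a b a' b' =
  gram (pair_family psi k l) a b a' b'.
Proof.
move=> jk lj ef; rewrite !gram_pair_family -mulrDr; congr (_ * _).
pose G g := psi (upd (upd g k a) l b) * (psi (upd (upd g k a') l b'))^*.
have hG := sum_upd G j.
transitivity (2^-1 * \sum_g \sum_c G (upd g j c)); last by rewrite hG; field.
rewrite -big_split big_distrr; apply: eq_bigr => g _ /=.
have efE c d : e c 0 * (e d 0)^* + f c 0 * (f d 0)^* = (c == d)%:R.
  by have /matrixP/(_ c d) := ef; rewrite !mxE !big_ord1 !mxE.
have H c : upd (upd (upd g j c) k a) l b = upd (upd (upd g k a) l b) j c.
  by rewrite (updC _ _ _ jk) updC // eq_sym.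
have H' c : upd (upd (upd g j c) k a') l b' = upd (upd (upd g k a') l b') j c.
  by rewrite (updC _ _ _ jk) updC // eq_sym.
rewrite /measured /G !sum_I2 !H !H' !rmorphM !rmorphD !rmorphM /=.
set u := upd (upd g k a) l b; set v := upd (upd g k a') l b'.
move: (efE 0 0) (efE 0 1) (efE 1 0) (efE 1 1) => /= e00 e01 e10 e11.
set q := (Num.sqrt _)%:C%C.
transitivity (q * q^* * (
  (e 0 0 * (e 0 0)^* + f 0 0 * (f 0 0)^*) * (psi (upd u j 0) * (psi (upd v j 0))^*) +
  (e 0 0 * (e 1 0)^* + f 0 0 * (f 1 0)^*) * (psi (upd u j 0) * (psi (upd v j 1))^*) +
  (e 1 0 * (e 0 0)^* + f 1 0 * (f 0 0)^*) * (psi (upd u j 1) * (psi (upd v j 0))^*) +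
  (e 1 0 * (e 1 0)^* + f 1 0 * (f 1 0)^*) * (psi (upd u j 1) * (psi (upd v j 1))^*))); first by ring.
by rewrite e00 e01 e10 e11 sqrt_half; ring.
Qed.

Lemma marginal_psd psi k : psd2 (marginal psi k).
Proof.
pose x f : M2 := \matrix_(a, b) ((Num.sqrt 2^-1)%:C%C * psi (upd f k a)).
suff -> : marginal psi k = post_state [seq x f | f <- enum (config n)] (basis_ket R 0).
  exact: post_state_psd.
apply/matrixP => a a'; rewrite post_stateE big_map big_enum mxE big_distrr /=.
apply: eq_bigr => f _.
have H c : (x f *m basis_ket R 0) c 0 = (Num.sqrt 2^-1)%:C%C * psi (upd f k c).
  by rewrite mxE sum_I2 !mxE /= mulr1 mulr0 addr0.
by rewrite !H rmorphM -sqrt_half /=; ring.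
Qed.

(** The state is arbitrary rather than normalised, because the outcomes to which the induction
    hypothesis applies are unnormalised. For the later qubits the bounds of the two outcomes are
    added, and [sum_sqrD] matches the first term in [measurement]; the measured qubit itself takes
    the term c^2. *)
Lemma pure_monogamy (J : seq 'I_n) k psi : uniq J -> k \notin J ->
  exists (c : 'I_n -> R) (F : 'I_n -> seq M2),
    (forall j, j \in J -> [/\ 0 <= c j, same_gram (F j) (pair_family psi k j) &
                             \sum_(x <- F j) cabs (mdet x) <= c j]) /\
    \sum_(j <- J) c j ^+ 2 <= rdet (marginal psi k).
Proof.
elim: J psi => [|j J IH] psi.
  move=> _ _; exists (fun _ => 0), (fun _ => [::]); split=> //.
  by rewrite big_nil; apply: psd2_rdet_ge0; exact: marginal_psd.
rewrite /= inE negb_or => /andP[jJ uJ] /andP[kj kJ].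
have jk : j != k by rewrite eq_sym.
have [e [f [t [c0 [ef tg c00 tc le]]]]] := measurement (pair_family psi k j).
have [ce [Fe [he se]]] := IH (measured psi j e) uJ kJ.
have [cf [Ff [hf sf]]] := IH (measured psi j f) uJ kJ.
exists (fun l => if l == j then c0 else ce l + cf l).
exists (fun l => if l == j then t else Fe l ++ Ff l).
have nj l : l \in J -> (l == j) = false.
  by move=> lJ; apply: contraNF jJ => /eqP <-.
split.
  move=> l; rewrite inE; case: eqVneq => [-> _|lj /= lJ]; first by split.
  have [e1 e2 e3] := he l lJ; have [f1 f2 f3] := hf l lJ; split.
  - exact: addr_ge0.
  - by move=> a b a' b'; rewrite gram_cat e2 f2 gram_measured.
  - by rewrite big_cat lerD.
rewrite big_cons eqxx addrC; apply: le_trans (_ : _ <= rdet (left_state (pair_family psi k j))) _; last first.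
  by rewrite left_state_family.
apply: le_trans le; rewrite lerD2r !post_state_family //.
rewrite big_seq; under eq_bigr => l lJ do rewrite nj //; rewrite -big_seq.
apply: sum_sqrD => // l lJ; first by have [] := he l lJ.
by have [] := hf l lJ.
Qed.

End Qubits.

End Configurations.

(** * Renyi entanglement *)

Lemma sum_enum_rank (V : nmodType) (T : finType) (F : 'I_#|T| -> V) :
  \sum_i F i = \sum_(t : T) F (enum_rank t).
Proof. by rewrite (reindex _ (onW_bij _ (@enum_rank_bij T))). Qed.

Section Entropy.
Variable R : realType.
Local Notation C := R[i].
Local Notation M2 := 'M[C]_2.
Implicit Types (x y z M : M2) (s t : seq M2).

Lemma entry_mkop (T : finType) (F : T -> T -> C) a b : entry (mkop F) a b = F a b.
Proof. by rewrite /entry mxE !enum_rankK. Qed.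

Lemma eq_mkop (T : finType) (F G : T -> T -> C) : F =2 G -> mkop F = mkop G.
Proof. by move=> FG; apply/matrixP => i j; rewrite !mxE FG. Qed.

Lemma mkop_entry (T : finType) (rho : op R T) : mkop (entry rho) = rho.
Proof. by apply/matrixP => i j; rewrite !mxE /entry !enum_valK. Qed.

Lemma trace_mxpowR n (rho : 'M[C]_n) (alpha : R) :
  \tr (mxpowR rho alpha) = (\sum_i complex.Re (spectral_diag rho 0 i) `^ alpha)%:C%C.
Proof.
rewrite /mxpowR -mulmxA mxtrace_mulC -mulmxA mulmxV ?spectral_unit // mulmx1.
by rewrite mxtrace_diag rmorph_sum; apply: eq_bigr => i _; rewrite mxE.
Qed.

(** For a qubit these two power sums determine the pair of eigenvalues, through its sum and
    product. *)
Lemma trace_spectral n (rho : 'M[C]_n) : rho \is normalmx ->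
  \tr rho = \sum_i spectral_diag rho 0 i /\
  \tr (rho *m rho) = \sum_i spectral_diag rho 0 i ^+ 2.
Proof.
move=> /orthomx_spectralP e; set P := spectralmx rho in e; set d := spectral_diag rho in e *.
have Pu : P \in unitmx by exact: spectral_unit.
have trD (D : 'M[C]_n) : \tr (invmx P *m D *m P) = \tr D.
  by rewrite mxtrace_mulC mulmxA mulmxV // mul1mx.
split; first by rewrite e trD mxtrace_diag.
rewrite e !mulmxA -(mulmxA _ P) mulmxV // mulmx1 -(mulmxA (invmx P)) trD mulmx_diag mxtrace_diag.
by apply: eq_bigr => i _; rewrite mxE expr2.
Qed.

(** The eigenvalues p, q satisfy p + q = 1, and 2 p q = (p + q)^2 - (p^2 + q^2) gives p q = det M;
    both are nonnegative since their product is and their sum is 1. *)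
Lemma renyi_entropy_qubit M (alpha : R) : 2 <= alpha -> psd2 M -> M 0 0 + M 1 1 = 1 ->
  renyi_entropy alpha (mkop (fun a b => M a b) : op R 'I_2) = qubit_renyi alpha (4 * rdet M).
Proof.
move=> a2 hM tr1; have [h0 h1 h10 hd] := hM.
set rho : op R 'I_2 := mkop _.
have rE a b : rho (enum_rank a) (enum_rank b) = M a b by rewrite mxE !enum_rankK.
have Mj a b : M a b = (M b a)^*.
  case: (ord2_cases a) => ->; case: (ord2_cases b) => ->; rewrite ?h10 ?conjCK //.
    by apply/esym/CrealP/ger0_real.
  by apply/esym/CrealP/ger0_real.
have her : rho \is hermsymmx.
  apply/is_hermitianmxP; rewrite expr0 scale1r; apply/matrixP => i j.
  by rewrite -(enum_valK i) -(enum_valK j) [RHS]mxE [in RHS]mxE !rE.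
have [t1 t2] := trace_spectral (hermitian_normalmx her).
have /mxOverP dr := hermitian_spectral_diag_real her.
pose p := complex.Re (spectral_diag rho 0 (enum_rank 0)).
pose q := complex.Re (spectral_diag rho 0 (enum_rank 1)).
have pE : spectral_diag rho 0 (enum_rank 0) = p%:C%C by rewrite RRe_real.
have qE : spectral_diag rho 0 (enum_rank 1) = q%:C%C by rewrite RRe_real.
move: t1; rewrite /mxtrace !sum_enum_rank !sum_I2 !rE tr1 pE qE -rmorphD => /complexI pq1.
move: t2; rewrite /mxtrace !sum_enum_rank !sum_I2 pE qE.
rewrite ![(rho *m rho) _ _]mxE !sum_enum_rank !sum_I2 !rE -!rmorphXn -rmorphD => t2.
have mE : mdet M = (p * q)%:C%C.
  have e2 : (2 : C) != 0 by rewrite pnatr_eq0.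
  apply: (mulfI e2).
  have -> : 2 * mdet M = (M 0 0 + M 1 1) ^+ 2 -
     (M 0 0 * M 0 0 + M 0 1 * M 1 0 + (M 1 0 * M 0 1 + M 1 1 * M 1 1)) by rewrite /mdet; ring.
  transitivity ((1 - (p ^+ 2 + q ^+ 2))%:C%C : C).
    by rewrite tr1 t2 expr1n rmorphB rmorph1.
  have -> : 1 - (p ^+ 2 + q ^+ 2) = 2 * (p * q).
    by have : (p + q) ^+ 2 = 1 by [rewrite -pq1 expr1n]; rewrite sqrrD; lra.
  by rewrite rmorphM rmorph_nat.
have dE : rdet M = p * q by rewrite /rdet mE.
have pq0 : 0 <= p * q by rewrite -dE psd2_rdet_ge0.
have [p0 q0] : 0 <= p /\ 0 <= q.
  by split; nra.
rewrite /renyi_entropy trace_mxpowR sum_enum_rank sum_I2 /= -/p -/q dE.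
by apply: qubit_renyiE.
Qed.

Definition amplitude (A B : finType) (psi : ket R (A * B)%type) a b : C := psi (enum_rank (a, b)) 0.

Lemma entry_proj (T : finType) (psi : ket R T) (s t : T) :
  entry (proj_ket psi) s t = psi (enum_rank s) 0 * (psi (enum_rank t) 0)^*.
Proof. by rewrite /entry mxE big_ord1 !mxE. Qed.

Lemma unit_ketP (T : finType) (psi : ket R T) :
  unit_ket psi <-> \sum_t cabs (psi (enum_rank t) 0) ^+ 2 = 1.
Proof.
have E : (psi ^t* *m psi) 0 0 = (\sum_t cabs (psi (enum_rank t) 0) ^+ 2)%:C%C.
  rewrite mxE sum_enum_rank rmorph_sum; apply: eq_bigr => t _.
  by rewrite !mxE mulrC mulCJ.
split=> [u|u].
  by apply: (@complexI R); rewrite -E u mxE.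
by apply/matrixP => i j; rewrite !ord1 E u mxE.
Qed.

Definition qubit_marginal (B : finType) (psi : ket R ('I_2 * B)%type) : M2 :=
  \matrix_(a, a') \sum_b amplitude psi a b * (amplitude psi a' b)^*.

Lemma qubit_marginal_psd (B : finType) (psi : ket R ('I_2 * B)%type) : psd2 (qubit_marginal psi).
Proof.
split; rewrite ?mxE.
- by apply: sumr_ge0 => x _; rewrite mul_conjC_ge0.
- by apply: sumr_ge0 => x _; rewrite mul_conjC_ge0.
- by rewrite rmorph_sum; apply: eq_bigr => x _; rewrite rmorphM /= conjCK mulrC.
have h a : complex.Re (\sum_b amplitude psi a b * (amplitude psi a b)^*) =
    \sum_b cabs (amplitude psi a b) ^+ 2.
  suff -> : \sum_b amplitude psi a b * (amplitude psi a b)^* =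
    (\sum_b cabs (amplitude psi a b) ^+ 2)%:C%C by [].
  by rewrite rmorph_sum; apply: eq_bigr => x _; rewrite mulCJ.
rewrite !h; exact: cauchy_schwarz_seq.
Qed.

Lemma qubit_marginal_trace (B : finType) (psi : ket R ('I_2 * B)%type) : unit_ket psi ->
  qubit_marginal psi 0 0 + qubit_marginal psi 1 1 = 1.
Proof.
move=> /unit_ketP u; rewrite -(sum_I2 (fun a => qubit_marginal psi a a)).
transitivity (\sum_t cabs (psi (enum_rank t) 0) ^+ 2)%:C%C; last by rewrite u.
have -> : \sum_t cabs (psi (enum_rank t) 0) ^+ 2 = \sum_a \sum_b cabs (psi (enum_rank (a, b)) 0) ^+ 2.
  by rewrite pair_bigA; apply: eq_bigr => -[].
rewrite rmorph_sum; apply: eq_bigr => a _; rewrite mxE rmorph_sum; apply: eq_bigr => b _.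
by rewrite mulCJ.
Qed.

Lemma pure_renyi_entE (B : finType) (alpha : R) (psi : ket R ('I_2 * B)%type) :
  2 <= alpha -> unit_ket psi ->
  pure_renyi_ent alpha psi = qubit_renyi alpha (4 * rdet (qubit_marginal psi)).
Proof.
move=> a2 u.
rewrite -(renyi_entropy_qubit a2 (qubit_marginal_psd psi) (qubit_marginal_trace u)).
congr (renyi_entropy _ _); apply: eq_mkop => a a'; rewrite mxE.
by apply: eq_bigr => b _; exact: entry_proj.
Qed.

Lemma psd2_rdet_le M : psd2 M -> M 0 0 + M 1 1 = 1 -> 0 <= 4 * rdet M <= 1.
Proof.
move=> h tr1; rewrite mulr_ge0 ?psd2_rdet_ge0 //= psd2_rdetE //.
have := sqr_ge0 (cabs (M 0 1)).
have : complex.Re (M 0 0) + complex.Re (M 1 1) = 1.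
  by move/(congr1 (@complex.Re R)): tr1; case: (M 0 0) (M 1 1) => ? ? [? ?].
have := sqr_ge0 (complex.Re (M 0 0) - complex.Re (M 1 1)); rewrite !expr2.
set p := complex.Re _; set q := complex.Re _ => h1 h2 h3; nra.
Qed.

Lemma pure_renyi_ent_ge0 (B : finType) (alpha : R) (psi : ket R ('I_2 * B)%type) :
  2 <= alpha -> unit_ket psi -> 0 <= pure_renyi_ent alpha psi.
Proof.
move=> a2 u; rewrite pure_renyi_entE //; apply: qubit_renyi_ge0 => //.
by apply: psd2_rdet_le; [exact: qubit_marginal_psd | exact: qubit_marginal_trace].
Qed.

Lemma average_ents_has_lbound (B : finType) (alpha : R) (rho : op R ('I_2 * B)%type) :
  2 <= alpha -> has_lbound (average_ents alpha rho).
Proof.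
move=> a2; exists 0 => e [k [p [psi [[p0 _ u _] ->]]]].
by apply: sumr_ge0 => i _; rewrite mulr_ge0 // pure_renyi_ent_ge0.
Qed.

Definition ket_of x : ket R ('I_2 * 'I_2)%type :=
  \col_i x (enum_val i).1 (enum_val i).2.

Lemma ket_ofE x a b : ket_of x (enum_rank (a, b)) 0 = x a b.
Proof. by rewrite mxE enum_rankK. Qed.

Lemma unit_ket_of x : weight x = 1 -> unit_ket (ket_of x).
Proof.
move=> w1; apply/unit_ketP; rewrite -w1 /weight pair_bigA /=.
by apply: eq_bigr => -[a b] _; rewrite ket_ofE.
Qed.

Lemma rdet_marginal_ket_of x : rdet (qubit_marginal (ket_of x)) = cabs (mdet x) ^+ 2.
Proof.
have -> : qubit_marginal (ket_of x) = x *m x ^t*.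
  apply/matrixP => a a'; rewrite !mxE; apply: eq_bigr => b _.
  by rewrite /amplitude !ket_ofE !mxE.
by rewrite /rdet mdetM mdetJ mulCJ.
Qed.

(* In a pair p of s, p.1 is an unnormalised state and p.2 bounds half of its
   normalised concurrence. *)
Lemma renyi_ent_le (alpha : R) (rho : op R ('I_2 * 'I_2)%type) (s : seq (M2 * R)) :
  2 <= alpha ->
  (forall a b a' b', gram [seq p.1 | p <- s] a b a' b' = entry rho (a, b) (a', b')) ->
  \sum_(p <- s) weight p.1 = 1 ->
  (forall p, p \in s -> [/\ 0 <= p.2, 4 * p.2 ^+ 2 <= 1 & cabs (mdet p.1) <= p.2 * weight p.1]) ->
  renyi_ent alpha rho <= \sum_(p <- s) weight p.1 * qubit_renyi alpha (4 * p.2 ^+ 2).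
Proof.
move=> a2 g s1 sb.
(* A member of weight 0 gets probability 0 but still needs a unit vector; |00> serves as the
   default. *)
pose u : M2 := \matrix_(a, b) ((a == 0) && (b == 0))%:R.
have u1 : weight u = 1.
  by rewrite /weight !sum_I2 !mxE /= /cabs /= !expr0n /= expr1n !addr0 sqrtr0 sqrtr1 expr0n /= expr1n !addr0.
pose nx x : M2 := if weight x == 0 then u else (Num.sqrt (weight x))^-1%:C%C *: x.
have nx1 x : weight (nx x) = 1.
  rewrite /nx; case: eqP => [//|/eqP w0].
  rewrite weight_scale cabs_real ger0_norm ?invr_ge0 ?sqrtr_ge0 // exprVn sqr_sqrtr ?weight_ge0 //.
  by rewrite mulVf.
have nxw x : weight x != 0 -> cabs (mdet (nx x)) = cabs (mdet x) / weight x.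
  move=> w0; rewrite /nx (negbTE w0) mdet_scale cabsM expr2 cabsM cabs_real.
  rewrite ger0_norm ?invr_ge0 ?sqrtr_ge0 // -expr2 exprVn sqr_sqrtr ?weight_ge0 //.
  by rewrite mulrC.
pose k := size s; pose Z (i : 'I_k) := nth (0, 0) s i.
have sumZ (V : nmodType) (F : M2 * R -> V) : \sum_(p <- s) F p = \sum_i F (Z i).
  by rewrite (big_nth (0, 0)) big_mkord.
have Zs i : Z i \in s by apply: mem_nth.
apply: le_trans (_ : \sum_i weight (Z i).1 * pure_renyi_ent alpha (ket_of (nx (Z i).1)) <= _).
  apply: ge_inf; first exact: average_ents_has_lbound.
  exists k, (fun i => weight (Z i).1), (fun i => ket_of (nx (Z i).1)); split=> //; split.
  - by move=> i; exact: weight_ge0.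
  - by rewrite -(sumZ _ (fun p => weight p.1)).
  - by move=> i; apply: unit_ket_of.
  rewrite -[LHS]mkop_entry -[RHS]mkop_entry; apply: eq_mkop => -[a b] [a' b'].
  rewrite -g /gram big_map sumZ /entry summxE; apply: eq_bigr => i _.
  rewrite mxE -/(entry _ _ _) entry_proj !ket_ofE.
  rewrite /nx; case: eqP => [w0|/eqP w0].
    by rewrite w0 (weight_eq0 w0) !mxE !mul0r.
  rewrite !mxE rmorphM /=; set w := weight _ in w0 *.
  set r := (Num.sqrt w)^-1%:C%C.
  have rr : w%:C%C * (r * r^*) = 1 :> C.
    rewrite mulCJ cabs_real ger0_norm ?invr_ge0 ?sqrtr_ge0 // exprVn sqr_sqrtr ?weight_ge0 //.
    by rewrite -rmorphM mulfV.
  transitivity (w%:C%C * (r * r^*) * ((Z i).1 a b * ((Z i).1 a' b')^*)); first by rewrite rr mul1r.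
  by ring.
rewrite sumZ; apply: ler_sum => i _.
have [->|w0] := eqVneq (weight (Z i).1) 0; first by rewrite !mul0r.
rewrite ler_wpM2l ?weight_ge0 // (pure_renyi_entE a2 (unit_ket_of (nx1 _))).
rewrite rdet_marginal_ket_of (nxw _ w0).
have [c0 c1 cb] := sb _ (Zs i).
have wp : 0 < weight (Z i).1 by rewrite lt_neqAle eq_sym w0 weight_ge0.
have h : cabs (mdet (Z i).1) / weight (Z i).1 <= (Z i).2 by rewrite ler_pdivrMr.
have h0 : 0 <= cabs (mdet (Z i).1) / weight (Z i).1 by rewrite divr_ge0 ?cabs_ge0 ?weight_ge0.
apply: qubit_renyi_homo => //; first by rewrite mulr_ge0 ?sqr_ge0.
by rewrite ler_wpM2l // ler_sqr ?nnegrE.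
Qed.

(** The spectral decomposition, whose eigenkets are the adjoints of the rows of the diagonalising
    unitary. It provides the nonemptiness without which a lower bound says nothing about the
    infimum. *)
Lemma density_decomposition (T : finType) (rho : op R T) : density rho ->
  exists (m : nat) (p : 'I_m -> R) (psi : 'I_m -> ket R T), pure_decomposition rho p psi.
Proof.
move=> [her pos tr1]; have nor := hermitian_normalmx her.
have /orthomx_spectralP e := nor; have [t1 _] := trace_spectral nor.
have Pu : spectralmx rho \is unitarymx by exact: spectral_unitarymx.
move: e t1; rewrite invmx_unitary //; set P := spectralmx rho in Pu *.
set d := spectral_diag rho => e t1.
have PP : P *m P ^t* = 1%:M by exact/unitarymxP.
pose w j : ket R T := (row j P) ^t*.
have wE j : w j ^t* = row j P by rewrite trmxCK.
have uw j : unit_ket (w j).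
  apply/matrixP => x y; rewrite /unit_ket wE !ord1.
  have /matrixP/(_ j j) := PP; rewrite !mxE !eqxx => h; apply: etrans h.
  by apply: eq_bigr => i _; rewrite !mxE.
have rowP j : row j P *m P ^t* = delta_mx 0 j by rewrite -row_mul PP row1.
have dE j : (w j ^t* *m rho *m w j) 0 0 = d 0 j.
  rewrite wE e !mulmxA rowP -(mulmxA _ P).
  have -> : P *m w j = (delta_mx 0 j : 'rV_#|T|)^T.
    apply/matrixP => x y; have /matrixP/(_ x j) := PP; rewrite !mxE => h.
    rewrite !ord1 eq_sym [j == x]eq_sym eqxx /=; apply: etrans h.
    by apply: eq_bigr => i _; rewrite !mxE.
  by rewrite -rowE trmx_delta -colE !mxE eqxx.
have d0 j : 0 <= d 0 j by rewrite -dE; exact: pos.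
have dR j : (complex.Re (d 0 j))%:C%C = d 0 j by rewrite RRe_real // ger0_real.
exists #|T|, (fun j => complex.Re (d 0 j)), w; split=> //.
- by move=> j; rewrite -ler0c dR.
- apply: (@complexI R); apply: etrans (_ : \sum_j d 0 j = 1); last by rewrite -t1 tr1.
  by rewrite rmorph_sum; apply: eq_bigr => j _; exact: dR.
rewrite {1}e; apply/matrixP => x y; rewrite summxE mxE; apply: eq_bigr => j _.
by rewrite dR mul_mx_diag !mxE big_ord1 !mxE conjCK mulrA (mulrC _ (d 0 j)).
Qed.

End Entropy.

(** * From pure to mixed states *)

Section Main.
Variables (R : realType) (n : nat).
Local Notation C := R[i].
Local Notation M2 := 'M[C]_2.
Implicit Types (f g : config n) (j k l : 'I_n) (a b : 'I_2) (psi : config n -> C).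

Definition other_qubits k f : config n.-1 := [ffun x => f (lift k x)].

Lemma join_configK k f : join_config k (f k) (other_qubits k f) = f.
Proof.
apply/ffunP => i; rewrite ffunE; case: unliftP => [j ->|->] //.
by rewrite ffunE.
Qed.

Lemma join_config_at k a (x : config n.-1) : join_config k a x k = a.
Proof. by rewrite ffunE unlift_none. Qed.

Lemma other_qubits_join k a (x : config n.-1) : other_qubits k (join_config k a x) = x.
Proof. by apply/ffunP => i; rewrite !ffunE liftK. Qed.

Lemma upd_join k a b (x : config n.-1) : upd (join_config k b x) k a = join_config k a x.
Proof.
apply/ffunP => i; rewrite !ffunE; have [->|ik] := eqVneq i k; first by rewrite unlift_none.
by case: unliftP ik => [j ->|->] //; rewrite eqxx.
Qed.

Lemma sum_join_config (V : nmodType) k (F : config n -> V) :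
  \sum_f F f = \sum_(a : 'I_2) \sum_(x : config n.-1) F (join_config k a x).
Proof.
rewrite pair_bigA /= (reindex (fun p : 'I_2 * config n.-1 => join_config k p.1 p.2)) //=.
apply: onW_bij; exists (fun f => (f k, other_qubits k f)) => [[a x]|f] /=.
  by rewrite join_config_at other_qubits_join.
exact: join_configK.
Qed.

Lemma sum_upd2 (F : config n -> C) k j :
  4 * \sum_f F f = \sum_f \sum_a \sum_b F (upd (upd f k a) j b).
Proof.
rewrite (sum_upd (fun f => \sum_b F (upd f j b))) (sum_upd F).
by ring.
Qed.

(** In the partial trace g is determined by f and (a', b'), so the inner sum has one term. Letting f
    run freely with its bits k and j overwritten repeats each term four times, which matches
    [gram_pair_family]. *)
Lemma entry_reduced_state k j (rho : op R (config n)) a b a' b' : j != k ->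
  entry (reduced_state k j rho) (a, b) (a', b') =
  4^-1 * \sum_f entry rho (upd (upd f k a) j b) (upd (upd f k a') j b').
Proof.
move=> jk; rewrite entry_mkop; have kj : (k == j) = false by rewrite eq_sym (negbTE jk).
pose H f := entry rho f (upd (upd f k a') j b').
have inner f : \sum_(g : config n | ((g k, g j) == (a', b')) &&
    [forall l, (l \notin [:: k; j]) ==> (f l == g l)]) entry rho f g = H f.
  apply: big_pred1 => g; apply/idP/eqP.
    case/andP => /eqP[gk gj] /forallP h; apply/ffunP => l; rewrite !ffunE.
    have [->|lj] := eqVneq l j; first by [].
    have [->|lk] := eqVneq l k; first by [].
    by have := h l; rewrite !inE negb_or lk lj /= => /eqP.
  move=> ->; rewrite !ffunE kj !eqxx /=.
  apply/forallP => l; apply/implyP; rewrite !inE negb_or => /andP[lk lj].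
  by rewrite !ffunE (negbTE lk) (negbTE lj).
under eq_bigr do rewrite inner.
pose G f : C := if (f k, f j) == (a, b) then H f else 0.
transitivity (\sum_f G f); first by rewrite big_mkcond.
transitivity (4^-1 * (4 * \sum_f G f)); first by field.
rewrite (sum_upd2 G k j); congr (_ * _); apply: eq_bigr => f _.
have GE c d : G (upd (upd f k c) j d) = if (c == a) && (d == b) then H (upd (upd f k c) j d) else 0.
  by rewrite /G !ffunE kj !eqxx xpair_eqE.
have HE : H (upd (upd f k a) j b) = entry rho (upd (upd f k a) j b) (upd (upd f k a') j b').
  rewrite /H; congr (entry _ _ _); apply/ffunP => l; rewrite !ffunE.
  by case: eqVneq => // _; case: eqVneq.
rewrite -HE.
transitivity (\sum_c \sum_d if (c == a) && (d == b) then H (upd (upd f k c) j d) else 0).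
  by apply: eq_bigr => c _; apply: eq_bigr => d _; exact: GE.
rewrite (bigD1 a) //= (bigD1 b) //= !eqxx /= !big1 ?addr0 //.
  by move=> c ca; rewrite big1 // => d _; rewrite (negbTE ca).
by move=> d db; rewrite (negbTE db).
Qed.

Definition amplitudes k (phi : ket R ('I_2 * config n.-1)%type) : config n -> C :=
  fun f => phi (enum_rank (f k, other_qubits k f)) 0.

Lemma marginal_amplitudes k phi : marginal (amplitudes k phi) k = qubit_marginal phi.
Proof.
apply/matrixP => a a'; rewrite !mxE (sum_join_config k) sum_I2.
under eq_bigr do rewrite !upd_join.
under [X in _ * (_ + X)]eq_bigr do rewrite !upd_join.
have -> : \sum_(x : config n.-1) amplitudes k phi (join_config k a x) *
   (amplitudes k phi (join_config k a' x))^* = \sum_b amplitude phi a b * (amplitude phi a' b)^*.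
  by apply: eq_bigr => x _; rewrite /amplitudes !join_config_at !other_qubits_join.
by field.
Qed.

Lemma left_state_trace (s : seq M2) :
  left_state s 0 0 + left_state s 1 1 = (\sum_(x <- s) weight x)%:C%C.
Proof.
rewrite /left_state !summxE -big_split rmorph_sum; apply: eq_bigr => x _ /=.
rewrite !mxE /weight !sum_I2 !mxE !rmorphD /= -!mulCJ; ring.
Qed.

(** The numbers 4 c_j^2 bound squared concurrences and add up to at most 4 det rho_A1 <= 1, so
    superadditivity and monotonicity of [qubit_renyi] apply. Normalisation of phi gives every pair
    family total weight 1, as equalisation requires. *)
Lemma pure_decompositions k (alpha : R) (phi : ket R ('I_2 * config n.-1)%type) :
  2 <= alpha -> unit_ket phi ->
  exists (c : 'I_n -> R) (T : 'I_n -> seq M2),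
    (forall j, j != k ->
      [/\ 0 <= c j, 4 * c j ^+ 2 <= 1, same_gram (T j) (pair_family (amplitudes k phi) k j),
          \sum_(x <- T j) weight x = 1 & forall x, x \in T j -> cabs (mdet x) <= c j * weight x]) /\
    \sum_(j | j != k) qubit_renyi alpha (4 * c j ^+ 2) <= pure_renyi_ent alpha phi.
Proof.
move=> a2 u; pose psi := amplitudes k phi.
pose J := enum [pred j | j != k].
have JE j : (j \in J) = (j != k) by rewrite mem_enum inE.
have [|c [F [hF le]]] := @pure_monogamy _ _ J k psi (enum_uniq _); first by rewrite JE eqxx.
move: le; rewrite marginal_amplitudes big_enum_cond /= => le.
have /andP[d0 d1] := psd2_rdet_le (qubit_marginal_psd phi) (qubit_marginal_trace u).
have sumc : \sum_(j | j != k) 4 * c j ^+ 2 <= 4 * rdet (qubit_marginal phi).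
  rewrite -big_distrr ler_pM2l //=; apply: le_trans le.
  by rewrite le_eqVlt; apply/orP; left; apply/eqP; apply: eq_bigl => j; rewrite !inE ?andbT.
have w1 j : j != k -> \sum_(x <- F j) weight x = 1.
  move=> jk; have [_ Fj _] := hF j (etrans (JE j) jk).
  rewrite (same_gram_weight Fj); apply: (@complexI R).
  by rewrite -left_state_trace left_state_family // marginal_amplitudes qubit_marginal_trace.
(* The choice ranges over all j; at j = k the empty family is a dummy. *)
have /choice[T hT] : forall j, exists t, j != k -> same_gram t (F j) /\
    forall x, x \in t -> cabs (mdet x) <= c j * weight x.
  move=> j; have [->|jk] := eqVneq j k; first by exists [::].
  have [_ _ h] := hF j (etrans (JE j) jk).
  by have [t ht] := equal_concurrence (w1 j jk) h; exists t.
exists c, T; split.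
  move=> j jk; have [c0 Fj _] := hF j (etrans (JE j) jk); have [T1 T2] := hT j jk.
  split=> //; last by rewrite (same_gram_weight T1) w1.
    apply: le_trans d1; apply: le_trans sumc.
    by rewrite (bigD1 j) //= lerDl; apply: sumr_ge0 => *; rewrite mulr_ge0 ?sqr_ge0.
  exact: same_gram_trans Fj.
have p0 j : 0 <= 4 * c j ^+ 2 by rewrite mulr_ge0 ?sqr_ge0.
rewrite (pure_renyi_entE a2 u).
apply: le_trans (qubit_renyi_homo a2 _ sumc d1); last by exact: sumr_ge0.
by apply: qubit_renyi_sum => //; apply: le_trans d1.
Qed.

(** Given any decomposition of rho across the cut, those of the pair marginals of its members are
    scaled by sqrt (p i) and concatenated. Each piece keeps its own bound c i j, so the estimate is
    linear in the p i and reduces to the pure case member by member. *)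
Lemma monogamy_decomposition k (alpha : R) (rho : op R (config n)) (e : R) : 2 <= alpha ->
  average_ents alpha (cut_state k rho) e ->
  \sum_(j < n | j != k) renyi_ent alpha (reduced_state k j rho) <= e.
Proof.
move=> a2 [m [p [phi [[p0 p1 u rhoE] ->]]]].
have /choice[c0 h0] := fun i : 'I_m => pure_decompositions k a2 (u i).
have /choice[T0 h1] := h0.
pose c (i : 'I_m) j := c0 i j; pose T (i : 'I_m) j := T0 i j.
have rE f g : entry rho f g =
    \sum_(i < m) (p i)%:C%C * (amplitudes k (phi i) f * (amplitudes k (phi i) g)^*).
  have <- : entry (cut_state k rho) (f k, other_qubits k f) (g k, other_qubits k g) = entry rho f g.
    by rewrite entry_mkop /= !join_configK.
  rewrite rhoE /entry summxE; apply: eq_bigr => i _; rewrite mxE; congr (_ * _).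
  exact: entry_proj.
have bound j : j != k -> renyi_ent alpha (reduced_state k j rho) <=
    \sum_(i < m) p i * qubit_renyi alpha (4 * c i j ^+ 2).
  move=> jk.
  pose s : seq (M2 * R) :=
    flatten [seq [seq ((Num.sqrt (p i))%:C%C *: x, c i j) | x <- T i j] | i <- enum 'I_m].
  have sumS (V : nmodType) (G : M2 * R -> V) : \sum_(q <- s) G q =
      \sum_(i < m) \sum_(x <- T i j) G ((Num.sqrt (p i))%:C%C *: x, c i j).
    rewrite /s big_flatten big_map big_enum; apply: eq_bigr => i _; exact: big_map.
  have wS (i : 'I_m) (x : M2) : weight ((Num.sqrt (p i))%:C%C *: x) = p i * weight x.
    by rewrite weight_scale cabs_real ger0_norm ?sqrtr_ge0 // sqr_sqrtr.
  have Tj (i : 'I_m) := (h1 i).1 j jk.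
  have -> : \sum_(i < m) p i * qubit_renyi alpha (4 * c i j ^+ 2) =
      \sum_(q <- s) weight q.1 * qubit_renyi alpha (4 * q.2 ^+ 2).
    rewrite sumS; apply: eq_bigr => i _ /=.
    have [_ _ _ w1 _] := Tj i.
    under eq_bigr do rewrite wS.
    by rewrite -big_distrl -big_distrr /= w1 mulr1.
  apply: renyi_ent_le => //.
  - move=> a b a' b'; rewrite entry_reduced_state // /gram big_map sumS /=.
    transitivity (\sum_(i < m) (p i)%:C%C * gram (pair_family (amplitudes k (phi i)) k j) a b a' b').
      apply: eq_bigr => i _; have [_ _ g _ _] := Tj i; rewrite -g /gram big_distrr.
      apply: eq_bigr => x _ /=; rewrite !mxE rmorphM /=.
      have := real_scale (Num.sqrt (p i)); rewrite sqr_sqrtr // => <-; ring.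
    under [X in _ = _ * X]eq_bigr do rewrite rE.
    rewrite exchange_big big_distrr; apply: eq_bigr => i _ /=.
    by rewrite gram_pair_family -big_distrr /=; ring.
  - rewrite sumS -p1; apply: eq_bigr => i _ /=; have [_ _ _ w1 _] := Tj i.
    by under eq_bigr do rewrite wS; rewrite -big_distrr w1 /= mulr1.
  - move=> q /flattenP[/= _ /mapP[i _ ->] /mapP[x xT ->]] /=.
    have [c0' c1 _ _ cb] := Tj i; split=> //.
    rewrite mdet_scale cabsM expr2 cabsM cabs_real ger0_norm ?sqrtr_ge0 // -expr2 sqr_sqrtr //.
    by rewrite wS mulrCA ler_wpM2l // cb.
apply: le_trans (_ : \sum_(j < n | j != k) \sum_(i < m) p i * qubit_renyi alpha (4 * c i j ^+ 2) <= _).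
  by apply: ler_sum => j; exact: bound.
rewrite exchange_big; apply: ler_sum => i _ /=; rewrite -big_distrr ler_wpM2l //=.
exact: (h1 i).2.
Qed.

Lemma average_ents_cut_neq0 k (alpha : R) (rho : op R (config n)) : density rho ->
  average_ents alpha (cut_state k rho) !=set0.
Proof.
move=> /density_decomposition[m [p [psi [p0 p1 u rhoE]]]].
pose phi i : ket R ('I_2 * config n.-1)%type :=
  \col_x psi i (enum_rank (join_config k (enum_val x).1 (enum_val x).2)) 0.
exists (\sum_(i < m) p i * pure_renyi_ent alpha (phi i)), m, p, phi; split=> //; split=> //.
  move=> i; apply/unit_ketP; have /unit_ketP := u i; rewrite (sum_join_config k) => <-.
  rewrite pair_bigA; apply: eq_bigr => -[a x] _ /=.
  by rewrite mxE enum_rankK.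
rewrite -[RHS]mkop_entry; apply: eq_mkop => s t.
rewrite rhoE /entry !summxE; apply: eq_bigr => i _; rewrite !mxE !big_ord1 !mxE.
by rewrite !enum_rankK.
Qed.

End Main.

Theorem theorem4 (R : realType) (alpha : R) (n : nat) (hn : (1 < n)%N)
    (rho : op R (config n)) (halpha : 2 <= alpha) (hrho : density rho) :
  renyi_ent alpha (cut_state (first_qubit hn) rho) >=
  \sum_(i < n | i != first_qubit hn)
    renyi_ent alpha (reduced_state (first_qubit hn) i rho).
Proof.
apply: lb_le_inf; first exact: average_ents_cut_neq0.
by move=> e; exact: monogamy_decomposition.
Qed.
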